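(* Let $\Omega\subset\mathbb{R}^n$ be a bounded domain with $C^1$ boundary, $s\in(0,1)$, $\gamma>0$ and $r>1$. There exists a positive number $\overline{\Lambda}$ such that the problem $$-\Delta u+(-\Delta)^s u=\frac{\lambda}{u^{\gamma}}+u^r\ \text{ in }\Omega,\qquad u>0\ \text{ in }\Omega,\qquad u=0\ \text{ in }\mathbb{R}^n\setminus\Omega,$$ has no weak solution (in the sense defined in the context) if $\lambda\ge\overline{\Lambda}$.
   Context: $W_0^{1,2}(\omega)$ is the closure of $C_c^\infty(\omega)$ in $W^{1,2}(\omega)$; functions on $\Omega$ (and test functions) are extended by zero to $\mathbb{R}^n$. $(-\Delta)^s$ is the fractional Laplacian (its normalization constant is dropped in the weak formulation). Weak solution: a function $u\in W_{\mathrm{loc}}^{1,2}(\Omega)\cap L^\infty(\Omega)$, positive in $\Omega$, zero outside $\Omega$ (the boundary condition being understood as some suitable positive power of $u$ belonging to $W_0^{1,2}(\Omega)$), such that for every open $\omega\subset\subset\Omega$ and every $\phi\in W_0^{1,2}(\omega)$ one has $\frac{\phi}{u^\gamma}\in L^1(\Omega)$ and $$\int_\Omega\nabla u\cdot\nabla\phi\,dx+\int_{\mathbb{R}^n}\int_{\mathbb{R}^n}\frac{(u(x)-u(y))(\phi(x)-\phi(y))}{|x-y|^{n+2s}}\,dx\,dy=\lambda\int_\Omega\frac{\phi}{u^\gamma}\,dx+\int_\Omega u^r\phi\,dx.$$ *)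

(* Defs.v *)
From HB Require Import structures.
From mathcomp Require Import all_boot all_order all_algebra.
From mathcomp Require Import all_classical all_reals all_analysis.
Set Implicit Arguments.
Unset Strict Implicit.
Unset Printing Implicit Defensive.
Import Order.TTheory GRing.Theory Num.Theory numFieldNormedType.Exports.
Local Open Scope classical_set_scope.
Local Open Scope ring_scope.

(* The sigma-algebra on R^n generated by the coordinates, i.e. the Borel
   sets. *)
Section rV_measurable.
Context (R : realType) (n : nat).

Definition rV_coord (i : 'I_n) (x : 'rV[R]_n) : R := x ord0 i.

Let rV_set0 : g_sigma_preimage rV_coord set0.
Proof. exact: sigma_algebra0. Qed.

Let rV_setC A : g_sigma_preimage rV_coord A -> g_sigma_preimage rV_coord (~` A).
Proof. exact: sigma_algebraC. Qed.

Let rV_bigcup (F : _^nat) : (forall i, g_sigma_preimage rV_coord (F i)) ->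
  g_sigma_preimage rV_coord (\bigcup_i (F i)).
Proof. exact: sigma_algebra_bigcup. Qed.

HB.instance Definition _ := @isMeasurable.Build default_measure_display
  'rV[R]_n (g_sigma_preimage rV_coord) rV_set0 rV_setC rV_bigcup.

End rV_measurable.

Lemma product_sigma_finite d1 d2 (T1 : measurableType d1)
    (T2 : measurableType d2) (R : realType)
    (m1 : {sigma_finite_measure set T1 -> \bar R})
    (m2 : {sigma_finite_measure set T2 -> \bar R}) :
  sigma_finite setT (m1 \x m2)%E.
Proof.
have /sigma_finiteP[F [TF ndF Foo]] := sigma_finiteT m1.
have /sigma_finiteP[G [TG ndG Goo]] := sigma_finiteT m2.
exists (fun k => F k `*` G k).
  rewrite -setXTT TF TG predeqE => -[x y]; split.
    move=> [/= [i _ Fix] [k _ Gky]]; exists (maxn i k) => //; split.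
    - by move: x Fix; exact/subsetPset/ndF/leq_maxl.
    - by move: y Gky; exact/subsetPset/ndG/leq_maxr.
  by move=> [i _ []/= ? ?]; split; exists i.
move=> k; have [? ?] := Foo k; have [? ?] := Goo k.
split; first exact: measurableX.
by rewrite product_measure1E// lte_mul_pinfty// ge0_fin_numE.
Qed.

Section lebesgue_rV.
Context (R : realType).

Lemma measurable_rV_coord n (i : 'I_n) :
  measurable_fun [set: 'rV[R]_n] (rV_coord i).
Proof.
move=> _ Y mY; rewrite setTI; apply: sub_sigma_algebra => /=.
rewrite -bigcup_seq/=; exists i => /=; first by rewrite mem_index_enum.
by exists Y => //; rewrite setTI.
Qed.

Lemma measurable_fun_rVP d (T : measurableType d) n (f : T -> 'rV[R]_n) :
  measurable_fun [set: T] f <->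
  forall i, measurable_fun [set: T] (rV_coord i \o f).
Proof.
split=> [mf i|mf]; first exact: measurableT_comp (measurable_rV_coord i) mf.
move=> _ A mA; rewrite setTI.
pose G := [set B : set 'rV[R]_n | measurable (f @^-1` B)].
suff: g_sigma_preimage (@rV_coord R n) `<=` G by apply.
apply: smallest_sub.
  split.
  - by rewrite /G/= preimage_set0.
  - by move=> B; rewrite /G/= setTD -preimage_setC => ?; exact: measurableC.
  - move=> F mF; rewrite /G/= preimage_bigcup.
    by apply: bigcupT_measurable => k; exact: mF.
rewrite -bigcup_seq => B [i _ [C mC <-]]; rewrite /G/= setTI.
by have := mf i measurableT C mC; rewrite setTI.
Qed.

Definition rV_cons n (p : R * 'rV[R]_n) : 'rV[R]_n.+1 :=
  \row_j (if unlift ord0 j is Some k then p.2 ord0 k else p.1).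

Definition rV_uncons n (x : 'rV[R]_n.+1) : R * 'rV[R]_n :=
  (x ord0 ord0, \row_k x ord0 (lift ord0 k)).

Lemma rV_consK n : cancel (@rV_cons n) (@rV_uncons n).
Proof.
move=> [a v]; rewrite /rV_uncons /rV_cons; congr pair.
  by rewrite mxE unlift_none.
by apply/rowP => k; rewrite !mxE liftK.
Qed.

Lemma measurable_rV_cons n :
  measurable_fun [set: measurableTypeR R * 'rV[R]_n] (@rV_cons n).
Proof.
apply/measurable_fun_rVP => i.
case: (unliftP ord0 i) => [k|] ->.
- rewrite (_ : _ \o _ = rV_coord k \o snd); last first.
    by apply/funext => p; rewrite /rV_coord /rV_cons /= mxE liftK.
  by apply: measurableT_comp => //; exact: measurable_rV_coord.
- rewrite (_ : _ \o _ = fst) //.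
  by apply/funext => p; rewrite /rV_coord /rV_cons /= mxE unlift_none.
Qed.

Lemma measurable_rV_uncons n :
  measurable_fun [set: 'rV[R]_n.+1]
    (@rV_uncons n : _ -> measurableTypeR R * 'rV[R]_n).
Proof.
apply/measurable_fun_pairP; split; first exact: (measurable_rV_coord ord0).
apply/measurable_fun_rVP => i.
rewrite (_ : _ \o _ = rV_coord (lift ord0 i)); first exact: measurable_rV_coord.
by apply/funext => x; rewrite /rV_coord /rV_uncons /= mxE.
Qed.

Section lebesgue_step.
Local Open Scope ereal_scope.
Context (n : nat) (mu : {sigma_finite_measure set 'rV[R]_n -> \bar R}).

Definition lebesgue_step : set 'rV[R]_n.+1 -> \bar R :=
  pushforward (@lebesgue_measure R \x mu) (@rV_cons n).

Let mcons (A : set 'rV[R]_n.+1) : measurable A ->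
  measurable (@rV_cons n @^-1` A : set (measurableTypeR R * 'rV[R]_n)).
Proof. by move=> mA; rewrite -[X in measurable X]setTI; exact: measurable_rV_cons. Qed.

Let step0 : lebesgue_step set0 = 0.
Proof. by rewrite /lebesgue_step /pushforward preimage_set0 measure0. Qed.

Let step_ge0 A : 0 <= lebesgue_step A.
Proof. by rewrite /lebesgue_step /pushforward; exact: measure_ge0. Qed.

Let step_sigma_additive : semi_sigma_additive lebesgue_step.
Proof.
move=> F mF tF mUF; rewrite /lebesgue_step /pushforward preimage_bigcup.
apply: measure_semi_sigma_additive.
- by move=> k; exact: mcons.
- apply/trivIsetP => /= i j _ _ ij; rewrite -preimage_setI.
  by move/trivIsetP : tF => /(_ _ _ _ _ ij) ->//; rewrite preimage_set0.
- by rewrite -preimage_bigcup; exact: mcons.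
Qed.

HB.instance Definition _ := isMeasure.Build _ _ _
  lebesgue_step step0 step_ge0 step_sigma_additive.

Let step_sigma_finite : sigma_finite setT lebesgue_step.
Proof.
have [F UF Foo] : sigma_finite setT (@lebesgue_measure R \x mu).
  exact: product_sigma_finite.
exists (fun k => @rV_uncons n @^-1` F k).
  by rewrite -preimage_bigcup -UF preimage_setT.
move=> k; have [mF Fk] := Foo k; split.
  by rewrite -[X in measurable X]setTI; exact: measurable_rV_uncons.
rewrite /lebesgue_step /pushforward -comp_preimage.
rewrite (_ : _ @^-1` _ = F k)//.
by apply/seteqP; split => p; rewrite /preimage/= rV_consK.
Qed.

HB.instance Definition _ := @Measure_isSigmaFinite.Build _ _ _
  lebesgue_step step_sigma_finite.

End lebesgue_step.

(* Lebesgue measure on R^n, as an n-fold product of Lebesgue measure on R. *)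
Fixpoint lebesgue n : {sigma_finite_measure set 'rV[R]_n -> \bar R} :=
  if n is k.+1 then lebesgue_step (lebesgue k) else dirac (0 : 'rV[R]_0).

Lemma lebesgue_box n (a b : 'rV[R]_n) : (forall i, a ord0 i <= b ord0 i) ->
  lebesgue n [set x : 'rV[R]_n | forall i, x ord0 i \in `[a ord0 i, b ord0 i]] =
    (\prod_(i < n) (b ord0 i - a ord0 i))%:E.
Proof.
elim: n a b => [|n IH] a b ab.
  rewrite big_ord0 /= diracE mem_set//.
  by move=> [].
rewrite big_ord_recl /= /lebesgue_step /pushforward.
pose a' := \row_(k < n) a ord0 (lift ord0 k).
pose b' := \row_(k < n) b ord0 (lift ord0 k).
pose B := [set x : 'rV[R]_n | forall i, x ord0 i \in `[a' ord0 i, b' ord0 i]].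
have -> : @rV_cons n @^-1` [set x | forall i, x ord0 i \in `[a ord0 i, b ord0 i]]
    = `[a ord0 ord0, b ord0 ord0] `*` B.
  apply/seteqP; split => [[t v]/= H|[t v]/= [tab vB] i].
    split=> [|i]; first by have := H ord0; rewrite /rV_cons mxE unlift_none.
    by have := H (lift ord0 i); rewrite /rV_cons !mxE liftK.
  rewrite /rV_cons mxE; case: (unliftP ord0 i) => [k|] -> //.
  by have := vB k; rewrite !mxE.
rewrite product_measure1E//; last first.
  rewrite (_ : B = \bigcap_(i in [set: 'I_n])
      (rV_coord i @^-1` `[a' ord0 i, b' ord0 i])); last first.
    by apply/seteqP; split => [x xB i _|x xB i]; [exact: xB|exact: (xB i I)].
  apply: fin_bigcap_measurable => // i _.
  by rewrite -[X in measurable X]setTI; exact: measurable_rV_coord.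
transitivity (@lebesgue_measure R `[a ord0 ord0, b ord0 ord0]%classic *
  lebesgue n B)%E; first by [].
rewrite lebesgue_measure_itv/= lte_fin IH; last by move=> i; rewrite !mxE.
rewrite EFinM; congr (_ * _)%E.
  case: ltP => // ba; have -> : b ord0 ord0 = a ord0 ord0; last by rewrite subrr.
  by apply/eqP; rewrite eq_le ba ab.
by congr EFin; apply: eq_bigr => i _; rewrite !mxE.
Qed.

End lebesgue_rV.

Section sobolev.
Context (R : realType).
Implicit Types n : nat.

(* The norm of 'rV[R]_n in the library is the sup norm. *)
Definition enorm n (x : 'rV[R]_n) : R :=
  Num.sqrt (\sum_(i < n) x ord0 i ^+ 2).

Definition partial n (i : 'I_n) (f : 'rV[R]_n -> R) : 'rV[R]_n -> R :=
  fun x => 'D_(delta_mx ord0 i) f x.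

Fixpoint Ck n (k : nat) (f : 'rV[R]_n -> R) : Prop :=
  continuous f /\
  if k is k'.+1 then
    forall i : 'I_n, (forall x, derivable f x (delta_mx ord0 i)) /\
                     Ck k' (partial i f)
  else True.

Definition test_function n (A : set 'rV[R]_n) (phi : 'rV[R]_n -> R) : Prop :=
  let supp := closure [set x | phi x != 0] in
  [/\ forall k, Ck k phi, compact supp & supp `<=` A].

Definition compactly_contained n (w A : set 'rV[R]_n) : Prop :=
  compact (closure w) /\ closure w `<=` A.

Definition L1loc n (A : set 'rV[R]_n) (f : 'rV[R]_n -> R) : Prop :=
  measurable_fun A f /\
  forall K, compact K -> K `<=` A ->
    (lebesgue R n).-integrable K (EFin \o f).

Definition Linfty n (A : set 'rV[R]_n) (f : 'rV[R]_n -> R) : Prop :=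
  measurable_fun A f /\
  exists M : R, {ae lebesgue R n, forall x, A x -> `|f x| <= M}.

Definition weak_gradient n (A : set 'rV[R]_n) (u : 'rV[R]_n -> R)
    (G : 'I_n -> 'rV[R]_n -> R) : Prop :=
  L1loc A u /\
  forall i, L1loc A (G i) /\
    forall phi, test_function A phi ->
      \int[lebesgue R n]_(x in A) (u x * partial i phi x) =
      - \int[lebesgue R n]_(x in A) (G i x * phi x).

Definition W12_sqnorm n (A : set 'rV[R]_n) (u : 'rV[R]_n -> R)
    (G : 'I_n -> 'rV[R]_n -> R) : \bar R :=
  (\int[lebesgue R n]_(x in A) ((u x) ^+ 2)%:E +
   \sum_(i < n) \int[lebesgue R n]_(x in A) ((G i x) ^+ 2)%:E)%E.

Definition W12 n (A : set 'rV[R]_n) (u : 'rV[R]_n -> R) : Prop :=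
  exists2 G, weak_gradient A u G & (W12_sqnorm A u G < +oo)%E.

Definition W12loc n (A : set 'rV[R]_n) (u : 'rV[R]_n -> R) : Prop :=
  forall w, open w -> compactly_contained w A -> W12 w u.

(* The elements of W_0^{1,2}(A) are regarded as functions on the whole space,
   extended by zero outside A. *)
Definition W12_0 n (A : set 'rV[R]_n) (u : 'rV[R]_n -> R) : Prop :=
  [/\ W12 A u, forall x, ~ A x -> u x = 0 &
      forall e : R, 0 < e -> exists psi G,
        [/\ test_function A psi, weak_gradient A (u \- psi) G &
            (W12_sqnorm A (u \- psi)%R G < e%:E)%E]].

(* Near each boundary point, and up to relabelling and reflecting the
   coordinate axes, A is the strict epigraph of a C^1 function of the other
   n - 1 coordinates. *)
Definition C1_boundary n (A : set 'rV[R]_n) : Prop :=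
  forall x0, (closure A `\` A°) x0 ->
    exists (i : 'I_n) (b : bool) (g : 'rV[R]_n.-1 -> R), Ck 1 g /\
      \forall x \near x0, A x <-> g (col' i x) < (-1) ^+ b * x ord0 i.

Definition bounded_C1_domain n (A : set 'rV[R]_n) : Prop :=
  [/\ open A, connected A, A !=set0, bounded_set A & C1_boundary A].

(* u is a representative defined on the whole space.  In weak_eq, every
   integral other than that of phi / u^gamma converges absolutely because u is
   bounded and in W^{1,2}_loc; Du and Dphi are determined almost everywhere. *)
Record weak_solution n (Omega : set 'rV[R]_n) (s gamma r lambda : R)
    (u : 'rV[R]_n -> R) : Prop := WeakSolution {
  weak_W12loc : W12loc Omega u ;
  weak_Linfty : Linfty Omega u ;
  weak_gt0 : {ae lebesgue R n, forall x, Omega x -> 0 < u x} ;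
  weak_eq0 : forall x, ~ Omega x -> u x = 0 ;
  weak_boundary : exists2 q : R, 0 < q & W12_0 Omega (fun x => u x `^ q) ;
  weak_eq : exists2 Du, weak_gradient Omega u Du &
    forall w phi, open w -> compactly_contained w Omega -> W12_0 w phi ->
      (lebesgue R n).-integrable Omega (fun x => (phi x / u x `^ gamma)%:E) /\
      forall Dphi, weak_gradient setT phi Dphi ->
        \int[lebesgue R n]_(x in Omega) (\sum_(i < n) Du i x * Dphi i x) +
        \int[(lebesgue R n \x lebesgue R n)%E]_z
          ((u z.1 - u z.2) * (phi z.1 - phi z.2) /
           enorm (z.1 - z.2) `^ (n%:R + 2 * s)) =
        lambda * \int[lebesgue R n]_(x in Omega) (phi x / u x `^ gamma) +
        \int[lebesgue R n]_(x in Omega) (u x `^ r * phi x)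
}.

End sobolev.

(* Main.v *)
From mathcomp Require Import all_boot all_order all_algebra.
From mathcomp Require Import all_classical all_reals all_analysis.
From mathcomp Require Import measurable_realfun ring lra.
Require Import Defs.
Set Implicit Arguments.
Unset Strict Implicit.
Unset Printing Implicit Defensive.
Import Order.TTheory GRing.Theory Num.Theory numFieldNormedType.Exports.
Local Open Scope classical_set_scope.
Local Open Scope ring_scope.

(* Choose a smooth bump phi supported in a cube inside Omega for which
     - Laplacian phi <= C phi   and   (-Delta)^s phi <= T phi   everywhere.
   The first holds because the profile exp(-1/(1-t^2)) is convex near the ends
   of its support, the second because near the boundary of the support, where
   phi is small, the mass of phi farther away makes (-Delta)^s phi negative.
   Testing the equation with phi and moving the operator onto phi gives
     int (lambda u^(-gamma) + u^r) phi <= (C + 2T) int u phi,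
   while lambda t^(-gamma) + t^r >= K t for all t > 0, with K as large as
   desired when lambda is large; this is absurd once K > C + 2T.
   The nonlocal form is first computed with the kernel truncated to
   2^-N <= |z| < 2^N (sup norm), where Fubini applies freely; dominated
   convergence then needs only the integrability of the full integrand. *)

(** * Borel sets and Lebesgue measure on R^n *)

(** The bump stands in for a first eigenfunction: only an upper bound of the operator by a multiple
    of phi is used, and u >= 0 lets such a bound be multiplied by u and integrated. Smoothness alone
    would bound the operator by a constant, which is useless near the edge of the support, where phi
    vanishes to infinite order; hence the care for both inequalities there. The bump is a tensor
    product of one-variable profiles supported in a cube. Derivatives and second differences then
    reduce to one variable, and sup-norm balls have an explicit volume; the Euclidean norm in the
    kernel enters only through |z| <= |z|_2 <= n |z|. Two symmetrizations occur. Exchanging z and -z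
    turns first differences of phi into second differences, of order |z|^2, which the kernel
    integrates near 0 because s < 1. Exchanging x and y splits the form into two equal halves,
    whence 2T. The threshold for lambda comes from the point U = K^(1/(r-1)), where t^r = K t: below
    U the singular term must dominate K t, which holds once lambda >= K U^(gamma+1). *)

Section measurable_rV_borel.
Context (R : realType) (n : nat).
Implicit Types x y : 'rV[R]_n.

Lemma normr_coord_le x i : `|x ord0 i| <= `|x|.
Proof.
have /mapP[j Hj ->] : `|x ord0 i| \in [seq `|x k.1 k.2| | k : 'I_1 * 'I_n].
  by apply/mapP; exists (ord0, i) => //=; rewrite mem_enum.
by rewrite [leRHS]/Num.norm /= mx_normrE; apply/bigmax_geP; right => /=; exists j.
Qed.

Lemma rV_norm_le x (M : R) :
  0 <= M -> (forall i, `|x ord0 i| <= M) -> `|x| <= M.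
Proof.
move=> M0 xM; rewrite [leLHS]/Num.norm /= mx_normrE; apply/bigmax_leP; split=> //.
by move=> [i j] _ /=; rewrite (ord1 i).
Qed.

Lemma rV_norm_lt x (M : R) :
  0 < M -> (forall i, `|x ord0 i| < M) -> `|x| < M.
Proof.
move=> M0 xM; rewrite [ltLHS]/Num.norm /= mx_normrE; apply/bigmax_ltP; split=> //.
by move=> [i j] _ /=; rewrite (ord1 i).
Qed.

Lemma measurable_rV_box (I : 'I_n -> set R) : (forall i, measurable (I i)) ->
  measurable [set x : 'rV[R]_n | forall i, I i (x ord0 i)].
Proof.
move=> mI; rewrite (_ : mkset _ = \bigcap_(i in [set: 'I_n])
    (@rV_coord R n i @^-1` I i)).
  apply: fin_bigcap_measurable => // i _.
  by rewrite -[X in measurable X]setTI; exact: measurable_rV_coord.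
by apply/seteqP; split => [x xB i _|x xB i]; [exact: xB|exact: (xB i Logic.I)].
Qed.

Lemma measurable_rV_ball x (e : R) :
  measurable [set y : 'rV[R]_n | `|y - x| < e].
Proof.
have [e0|e0] := leP e 0.
  rewrite (_ : mkset _ = set0); first exact: measurable0.
  by apply/seteqP; split => // y /=; rewrite ltNge (le_trans e0).
rewrite (_ : mkset _ =
    [set y : 'rV[R]_n | forall i, `]x ord0 i - e, x ord0 i + e[%classic (y ord0 i)]).
  apply: (@measurable_rV_box (fun i => `]x ord0 i - e, x ord0 i + e[%classic)).
  by move=> i; exact: measurable_itv.
apply/seteqP; split=> y /=.
  move=> yxe i; rewrite in_itv /=; have := normr_coord_le (y - x) i.
  rewrite !mxE => /le_lt_trans/(_ yxe); rewrite ltr_norml; lra.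
move=> H; apply: rV_norm_lt => // i; rewrite !mxE.
by have := H i; rewrite in_itv/= ltr_norml; lra.
Qed.

(** The sigma-algebra is generated by the coordinates, so an open set is exhausted by the countably
    many cubes with rational centre and radius 1/(k+1) that it contains. *)
Lemma open_measurable_rV (A : set 'rV[R]_n) : open A -> measurable A.
Proof.
move=> oA.
pose q_ (q : 'rV[rat]_n) : 'rV[R]_n := \row_i ratr (q ord0 i).
pose B (p : 'rV[rat]_n * nat) := [set y | `|y - q_ p.1| < p.2.+1%:R^-1].
rewrite (_ : A = \bigcup_p (if `[< B p `<=` A >] then B p else set0)).
  apply: countable_bigcupT_measurable; first exact: countableP.
  move=> p; case: ifP => // _; exact: measurable_rV_ball.
apply/seteqP; split=> [x Ax|x [p _]]; last by case: asboolP => // pA /pA.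
have /nbhs_ballP[e /= e0 eA] : nbhs x A by apply: open_nbhs_nbhs; split.
have [k ke] : exists k : nat, k.+1%:R^-1 < e / 2.
  exists (Num.truncn (e / 2)^-1).
  rewrite invf_plt ?posrE ?ltr0n ?divr_gt0//.
  by rewrite truncnS_gt ?invr_ge0 ?divr_ge0// ltW.
have kp : 0 < k.+1%:R^-1 :> R by rewrite invr_gt0 ltr0n.
have [d kd] : exists d : R, d = k.+1%:R^-1 by exists k.+1%:R^-1.
move: kp ke; rewrite /B /= -kd => d0 de.
have /choice[q qP] : forall i, exists q : rat, ratr q \in
    `]x ord0 i - d, x ord0 i + d[.
  by move=> i; apply: rat_in_itvoo; lra.
exists (\row_i q i, k) => //.
have H y : `|y - q_ (\row_i q i)| < d -> A y.
  move=> yq; apply: eA; rewrite mx_norm_ball /ball_ /=.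
  rewrite -(subrKA (q_ (\row_i q i)) x (- y)) (le_lt_trans (ler_normD _ _))//.
  rewrite (splitr e) ltrD//; last first.
    by rewrite distrC; exact: lt_trans de.
  apply: lt_trans de; apply: rV_norm_lt => // i; rewrite !mxE.
  by have := qP i; rewrite in_itv/= ltr_norml; lra.
rewrite asboolT /= -kd => [|y /=]; last exact: H.
apply: rV_norm_lt => // i; rewrite !mxE.
by have := qP i; rewrite in_itv/= ltr_norml; lra.
Qed.

Lemma continuous_measurable_rV (f : 'rV[R]_n -> R) :
  continuous f -> measurable_fun setT f.
Proof.
move=> cf; apply: (measurability _ (RGenOpens.measurableE R)) => //.
move=> _ [_ [a [b ->] <-]]; rewrite setTI.
apply: open_measurable_rV; by apply: open_comp => //; exact: interval_open.
Qed.

Lemma closed_measurable_rV (A : set 'rV[R]_n) : closed A -> measurable A.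
Proof.
move=> cA; rewrite -[A]setCK; apply: measurableC; apply: open_measurable_rV.
exact: closed_openC.
Qed.

Lemma compact_measurable_rV (A : set 'rV[R]_n) : compact A -> measurable A.
Proof.
move=> cA; apply: closed_measurable_rV; exact: compact_closed.
Qed.

Lemma measurable_rV_norm : measurable_fun setT (fun x : 'rV[R]_n => `|x|).
Proof. by apply: continuous_measurable_rV; exact: norm_continuous. Qed.

Lemma continuous_rVB x : continuous (fun y : 'rV[R]_n => y - x).
Proof.
move=> y.
have H := @cvgB R ('rV[R]_n : normedModType R) _ (nbhs y) _ id (fun=> x) y x.
by apply: H; [exact: cvg_id|exact: cvg_cst].
Qed.

Lemma continuous_rV_dist x : continuous (fun y : 'rV[R]_n => `|y - x|).
Proof.
move=> y; apply: (@continuous_comp _ _ _ (fun y : 'rV[R]_n => y - x) Num.norm).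
  exact: continuous_rVB.
exact: norm_continuous.
Qed.

Lemma closed_rV_closed_ball x (r : R) : closed [set y : 'rV[R]_n | `|y - x| <= r].
Proof.
apply: (@closed_comp _ _ (fun y : 'rV[R]_n => `|y - x|) [set z : R | z <= r]).
  by move=> y _; exact: continuous_rV_dist.
exact: closed_le.
Qed.

Lemma open_rV_ball x (r : R) : open [set y : 'rV[R]_n | `|y - x| < r].
Proof.
apply: (@open_comp _ _ (fun y : 'rV[R]_n => `|y - x|) [set z : R | z < r]).
  by move=> y _; exact: continuous_rV_dist.
exact: open_lt.
Qed.

Lemma compact_rV_closed_ball x (r : R) : compact [set y : 'rV[R]_n | `|y - x| <= r].
Proof.
apply: bounded_closed_compact; last exact: closed_rV_closed_ball.
exists (`|x| + r); split; first exact: num_real.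
move=> M xM y /= yx; rewrite -(subrK x y) (le_trans (ler_normD _ _))//.
by move: xM yx; lra.
Qed.

Lemma measurable_rV_closed_ball x (r : R) :
  measurable [set y : 'rV[R]_n | `|y - x| <= r].
Proof. by apply: closed_measurable_rV; exact: closed_rV_closed_ball. Qed.

Lemma lebesgue_ball_le (x : 'rV[R]_n) (r : R) : 0 <= r ->
  (lebesgue R n [set y : 'rV[R]_n | (`|y - x| <= r)%R] <= ((2 * r) ^+ n)%:E)%E.
Proof.
move=> r0.
apply: (@le_trans _ _ (lebesgue R n [set y : 'rV[R]_n | forall i,
   y ord0 i \in `[(x - const_mx r) ord0 i, (x + const_mx r) ord0 i]])).
  apply: le_measure; rewrite ?inE.
  - exact: measurable_rV_closed_ball.
  - apply: (@measurable_rV_box (fun i => `[(x - const_mx r) ord0 i, (x + const_mx r) ord0 i]%classic)).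
    by move=> i; exact: measurable_itv.
  - move=> y /= yxr i; have := le_trans (normr_coord_le _ i) yxr.
    by rewrite !mxE in_itv /= ler_norml; lra.
rewrite lebesgue_box => [|i]; last by rewrite !mxE; lra.
rewrite lee_fin (eq_bigr (fun=> 2 * r)); last by move=> i _; rewrite !mxE; ring.
by rewrite prodr_const card_ord.
Qed.

Lemma bounded_lebesgue_lty (A : set 'rV[R]_n) :
  measurable A -> bounded_set A -> (lebesgue R n A < +oo)%E.
Proof.
move=> mA [M [_ AM]].
apply: (@le_lt_trans _ _ (lebesgue R n [set y : 'rV[R]_n | `|y - 0| <= `|M| + 1])).
  apply: le_measure; rewrite ?inE//; first exact: measurable_rV_closed_ball.
  move=> y Ay /=; rewrite subr0; apply: AM Ay.
  by rewrite ltr_pwDr// ler_norm.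
by apply: (le_lt_trans (lebesgue_ball_le _ _)) => //; rewrite ltry.
Qed.

End measurable_rV_borel.

(** * Invariance of Lebesgue measure under translations and reflections *)

Section lebesgue_invariance.
Context (R : realType).
Local Open Scope ereal_scope.

Lemma lebesgue_integralS n (f : 'rV[R]_n.+1 -> \bar R) :
  measurable_fun setT f -> (forall x, 0 <= f x) ->
  \int[lebesgue R n.+1]_x f x =
  \int[@lebesgue_measure R]_t \int[lebesgue R n]_v f (rV_cons (t, v)).
Proof.
move=> mf f0.
have mfc : measurable_fun [set: measurableTypeR R * 'rV[R]_n] (f \o @rV_cons R n).
  by apply: measurableT_comp => //; exact: measurable_rV_cons.
transitivity (\int[(@lebesgue_measure R \x lebesgue R n)]_z (f \o @rV_cons R n) z).
  have := @ge0_integral_pushforward _ _ (measurableTypeR R * 'rV[R]_n)%type 'rV[R]_n.+1 R (@rV_cons R n)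
    (@measurable_rV_cons R n) 
    [the {measure set (measurableTypeR R * 'rV[R]_n) -> \bar R} of
      @lebesgue_measure R \x lebesgue R n] setT f measurableT mf.
  by rewrite preimage_setT; apply => y _; exact: f0.
by rewrite fubini_tonelli1//= => z; exact: f0.
Qed.

(** The condition [s * s = 1] means s = 1 or s = -1, so translations and reflections are treated
    together. The image measure agrees with Lebesgue measure on half-open intervals, which
    determines it. *)
Lemma lebesgue_integral_affine1 (a s : R) (f : R -> \bar R) :
  (s * s = 1)%R -> measurable_fun setT f -> (forall x, 0 <= f x) ->
  \int[@lebesgue_measure R]_t f (a + s * t)%R = \int[@lebesgue_measure R]_t f t.
Proof.
move=> s1 mf f0.
pose h := (fun t : measurableTypeR R => (a + s * t)%R : measurableTypeR R).
have mh : measurable_fun setT h.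
  by apply: measurable_funD => //; exact: measurable_funM.
have := @ge0_integral_pushforward _ _ (measurableTypeR R) (measurableTypeR R) R h mh (@lebesgue_measure R) setT f measurableT mf.
rewrite preimage_setT => /(_ (fun y _ => f0 y))/= <-.
apply: eq_measure_integral => //= A mA _; apply/esym.
apply: (@lebesgue_measure_unique R (pushforward (@lebesgue_measure R) h)) => //= _ [[x y]] _ <-.
have /orP[/eqP s_|/eqP s_] : (s == 1)%R || (s == -1)%R.
  by rewrite -eqf_sqr expr1n expr2 s1.
- rewrite /pushforward (_ : h @^-1` _ = `](x - a)%R, (y - a)%R]%classic).
    rewrite !lebesgue_measure_itv/= !lte_fin ltrD2r; case: ifP => // _.
    by rewrite -!EFinB; congr EFin; ring.
  by apply/seteqP; split=> t /=; rewrite /h s_ !in_itv/=; lra.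
- rewrite /pushforward (_ : h @^-1` _ = `[(a - y)%R, (a - x)%R[%classic).
    rewrite !lebesgue_measure_itv/= !lte_fin ltrD2l ltrN2; case: ifP => // _.
    by rewrite -!EFinB; congr EFin; ring.
  by apply/seteqP; split=> t /=; rewrite /h s_ !in_itv/=; lra.
Qed.

Lemma measurable_rV_affine n (a : 'rV[R]_n) (s : R) :
  measurable_fun setT (fun x : 'rV[R]_n => a + s *: x)%R.
Proof.
apply/measurable_fun_rVP => i.
rewrite (_ : _ \o _ = (fun x => a ord0 i + s * rV_coord i x)%R).
  apply: measurable_funD => //; apply: measurable_funM => //.
  exact: measurable_rV_coord.
by apply/funext => x /=; rewrite /rV_coord !mxE.
Qed.

Lemma lebesgue_integral_affine n (a : 'rV[R]_n) (s : R) (f : 'rV[R]_n -> \bar R) :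
  (s * s = 1)%R -> measurable_fun setT f -> (forall x, 0 <= f x) ->
  \int[lebesgue R n]_x f (a + s *: x)%R = \int[lebesgue R n]_x f x.
Proof.
move=> s1; elim: n a f => [|n IH] a f mf f0.
  by apply: eq_integral => x _; congr f; apply/rowP; case.
have maff := measurable_rV_affine a s.
rewrite (lebesgue_integralS mf f0).
rewrite (@lebesgue_integralS n (fun x => f (a + s *: x)%R)); last 2 first.
- exact: (measurableT_comp mf maff).
- by move=> x; exact: f0.
pose a' : 'rV[R]_n := \row_k a ord0 (lift ord0 k).
pose g t := \int[lebesgue R n]_v f (rV_cons (t, v)).
have mfc : measurable_fun [set: measurableTypeR R * 'rV[R]_n] (f \o @rV_cons R n).
  by apply: measurableT_comp => //; exact: measurable_rV_cons.
transitivity (\int[@lebesgue_measure R]_t g (a ord0 ord0 + s * t)%R).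
  apply: eq_integral => t _; rewrite /g.
  rewrite -(IH a' (fun v => f (rV_cons ((a ord0 ord0 + s * t)%R, v))))//.
    apply: eq_integral => v _; congr f; apply/rowP => j.
    rewrite /rV_cons !mxE; case: (unliftP ord0 j) => [k|] -> /=; by rewrite ?mxE.
  exact: (measurableT_comp mfc (measurable_pair1 _)).
apply: lebesgue_integral_affine1 => //.
  have H :=
    @measurable_fun_fubini_tonelli_F _ _ _ _ _ (lebesgue R n) _ mfc (fun z => f0 _). exact: H.
by move=> t; apply: integral_ge0.
Qed.

End lebesgue_invariance.

(** * Integrals of directional derivatives; test functions *)

Section rV_integrals.
Context (R : realType) (n : nat).
Implicit Types (f F : 'rV[R]_n -> R) (x v : 'rV[R]_n).
Local Notation leb := (lebesgue R n).

Lemma continuous_bounded_on_ball F (r : R) : continuous F ->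
  exists2 C : R, 0 <= C & forall x, `|x| <= r -> `|F x| <= C.
Proof.
move=> cF; have [r0|r0] := leP 0 r; last first.
  by exists 0 => // x xr; have := le_lt_trans xr r0; rewrite normr_lt0.
have [||c _ H] := @EVT_max_rV R n (fun x => `|F x|) _ _ (@compact_rV_closed_ball R n 0 r).
- by exists 0; rewrite /= subr0 normr0.
- apply: continuous_subspaceT => x.
  apply: (@continuous_comp _ _ _ F Num.norm); first exact: cF.
  exact: norm_continuous.
by exists `|F c| => // x xr; apply: H; rewrite inE /= subr0.
Qed.

Lemma integrable_bounded_support f (C M : R) (D : set 'rV[R]_n) :
  measurable D -> measurable_fun setT f -> (forall x, `|f x| <= C) ->
  (forall x, M < `|x| -> f x = 0) -> leb.-integrable D (EFin \o f).
Proof.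
move=> mD mf fC fM.
suff : leb.-integrable setT (EFin \o f).
  by move=> h; apply: integrableS h.
pose B := [set x : 'rV[R]_n | `|x| <= `|M|].
have mB : measurable B.
  by have := measurable_rV_closed_ball (0 : 'rV[R]_n) `|M|; under eq_set do rewrite subr0.
have -> : EFin \o f = (EFin \o f) \_ B.
  apply/funext => x; rewrite /patch; case: ifPn => //; rewrite notin_setE /B /= => xB.
  rewrite fM// (le_lt_trans (ler_norm _))// ltNge; exact/negP.
apply/(integrable_mkcond _ mB); apply: measurable_bounded_integrable => //.
- apply: bounded_lebesgue_lty => //; exists `|M|; split; first exact: num_real.
  by move=> z Mz x /= /le_trans; apply; exact: ltW.
- exact: measurable_funS mf.
- exists C; split; first exact: num_real.
  by move=> z Cz x /= _; rewrite (le_trans (fC x))// ltW.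
Qed.

Lemma continuous_bounded_support F (M : R) : continuous F ->
  (forall x, M < `|x| -> F x = 0) -> exists2 C : R, 0 <= C & forall x, `|F x| <= C.
Proof.
move=> cF FM; have [C C0 FC] := continuous_bounded_on_ball M cF.
exists C => // x; have [/FC//|/FM ->] := leP `|x| M; by rewrite normr0.
Qed.

Lemma lebesgue_integral_shift (a : 'rV[R]_n) (s : R) (f : 'rV[R]_n -> \bar R) :
  s * s = 1 -> measurable_fun setT f ->
  (\int[leb]_x f (a + s *: x)%R = \int[leb]_x f x)%E.
Proof.
move=> s1 mf; rewrite integralE [RHS]integralE.
have mp := measurable_funepos mf; have mn := measurable_funeneg mf.
congr (_ - _)%E.
- rewrite -(lebesgue_integral_affine a s1 mp); last by move=> x; exact: funepos_ge0.
  by apply: eq_integral => x _; rewrite !funeposE.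
- rewrite -(lebesgue_integral_affine a s1 mn); last by move=> x; exact: funeneg_ge0.
  by apply: eq_integral => x _; rewrite !funenegE.
Qed.

Lemma is_derive_line F x v (t : R) : derivable F (x + t *: v) v ->
  is_derive t 1 (fun t => F (x + t *: v)) ('D_v F (x + t *: v)).
Proof.
have E : (fun h : R => h^-1 *: (((fun t => F (x + t *: v)) \o shift t) (h *: (1:R)) - F (x + t *: v)))
    = (fun h : R => h^-1 *: ((F \o shift (x + t *: v)) (h *: v) - F (x + t *: v))).
  apply/funext => h /=; congr (_ *: (F _ - _)).
  by rewrite [h *: _]mulr1 scalerDl addrCA.
by move=> dF; constructor; rewrite /derivable /derive E.
Qed.

Lemma line_mvt F v x (h C : R) : (forall y, derivable F y v) -> 0 < h ->
  (forall t, 0 < t < h -> `|'D_v F (x + t *: v)| <= C) ->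
  `|F (x + h *: v) - F x| <= C * h.
Proof.
move=> dF h0 DC.
have isd (t : R) : is_derive t (1 : R) (fun t : R => F (x + t *: v)) ('D_v F (x + t *: v)).
  exact: is_derive_line.
have [|c] := @MVT R (fun t => F (x + t *: v)) (fun t => 'D_v F (x + t *: v)) 0 h h0 (fun t _ => isd t).
  apply: derivable_within_continuous => t _.
  by have [] := isd t.
rewrite in_itv /= scale0r addr0 subr0 => /DC Dc ->.
by rewrite normrM (gtr0_norm h0) ler_wpM2r// ltW.
Qed.

(* The integral of a directional derivative is the limit of the integrals of
   the difference quotients, which vanish by translation invariance. *)
Lemma Rintegral_derive_eq0 F v (M : R) : continuous F ->
  (forall x, derivable F x v) -> continuous (fun x => 'D_v F x) ->
  (forall x, M < `|x| -> F x = 0) -> \int[leb]_x 'D_v F x = 0.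
Proof.
move=> cF dF cD FM.
have mF := continuous_measurable_rV cF; have mD := continuous_measurable_rV cD.
have [CF CF0 FC] := continuous_bounded_support cF FM.
pose h k : R := k.+1%:R^-1.
have h0 k : 0 < h k by rewrite invr_gt0.
have h1 k : h k <= 1 by rewrite invf_le1// ler1n.
pose q k x := (h k)^-1 * (F (x + h k *: v) - F x).
have mFs k : measurable_fun setT (fun x => F (x + h k *: v)).
  rewrite (_ : (fun x => _) = F \o (fun x => h k *: v + 1 *: x)); last first.
    by apply/funext => x /=; rewrite scale1r addrC.
  by apply: measurableT_comp => //; exact: measurable_rV_affine.
have mq k : measurable_fun setT (q k).
  by apply: measurable_funM => //; exact: measurable_funB.
have iF := integrable_bounded_support measurableT mF FC FM.
have FsM k x : M + `|v| < `|x| -> F (x + h k *: v) = 0.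
  move=> xM; apply: FM.
  have : `|x| <= `|x + h k *: v| + `|v|.
    rewrite -{1}(addrK (h k *: v) x) (le_trans (ler_normB _ _))// lerD2l normrZ.
    by rewrite gtr0_norm// ler_piMl.
  by move: xM; lra.
have iFs k := integrable_bounded_support measurableT (mFs k) (fun x => FC _) (FsM k).
have q0 k : (\int[leb]_x (q k x)%:E = 0)%E.
  under eq_integral do rewrite EFinM.
  rewrite integralZl//; last first.
    rewrite (_ : (fun x => _) = (EFin \o (fun x => F (x + h k *: v)%R)) \- (EFin \o F))%E//.
    exact: integrableB.
  under eq_integral do rewrite EFinB.
  rewrite (integralB _ (iFs k) iF)//=.
  have -> : (\int[leb]_x (F (x + h k *: v)%R)%:E = \int[leb]_x (F x)%:E)%E.
    rewrite -[RHS](@lebesgue_integral_shift (h k *: v) 1 (EFin \o F)) ?mulr1//.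
      by apply: eq_integral => x _ /=; rewrite scale1r addrC.
    exact/measurable_EFinP.
  by rewrite subee ?mule0//; exact: integrable_fin_num.
(* As h <= 1, the difference quotients vanish outside the ball of radius M + |v|; inside it, the
   mean value theorem bounds them by the derivative along segments that stay in the ball of radius M
   + 2|v|. This yields the dominating function [g]. *)
have [C C0 DC] := continuous_bounded_on_ball (M + `|v| + `|v|) cD.
pose g x : R := C * \1_[set x : 'rV[R]_n | `|x - 0| <= M + `|v|] x.
have mB := measurable_rV_closed_ball (0 : 'rV[R]_n) (M + `|v|).
have mg : measurable_fun setT g.
  by apply: measurable_funM => //; exact: measurable_indic.
have ig : leb.-integrable setT (EFin \o g).
  apply: (@integrable_bounded_support _ C (M + `|v|)) => // x.
    rewrite /g normrM (ger0_norm C0) ler_piMr// indicE.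
    by case: (_ \in _); rewrite ?normr1 ?normr0.
  by rewrite /g indicE ltNge => /negP xM; rewrite memNset ?mulr0//= subr0.
have [] := @dominated_convergence _ _ R leb setT measurableT
  (fun k x => (q k x)%:E) (fun x => ('D_v F x)%:E) (EFin \o g).
- by move=> k; exact/measurable_EFinP.
- exact/measurable_EFinP.
- apply: aeW => x _; apply: cvg_EFin; first exact: nearW.
  have := dF x; rewrite /derivable => /cvg_ex[l Hl].
  have -> : 'D_v F x = l by exact: cvg_lim Hl.
  have hc : h k @[k --> \oo] --> (0 : R)^'.
    move=> A A0.
    have : \forall k \near \oo, h k != 0 -> A (h k) by exact: (@cvg_harmonic R _ A0).
    apply: filterS => k H; by apply: H; rewrite gt_eqF//; exact: h0.
  have := cvg_comp h _ hc Hl; apply: cvg_trans; apply: near_eq_cvg.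
  by apply: nearW => k; rewrite /q /= (addrC (h k *: v)).
- exact: ig.
- apply: aeW => x k _ /=; rewrite lee_fin.
  rewrite /g indicE; case: (boolP (_ \in _)) => [|/negP].
    rewrite inE /= subr0 mulr1 => xM.
    rewrite /q normrM normfV (gtr0_norm (h0 k)) ler_pdivrMl// mulrC.
    apply: line_mvt => // t /andP[t0 th]; apply: DC.
    rewrite (le_trans (ler_normD _ _))// lerD// normrZ gtr0_norm//.
    by rewrite ler_piMl// ltW// (lt_le_trans th).
  rewrite inE /= subr0 => /negP; rewrite -ltNge => xM.
  rewrite /q FsM// FM ?subrr ?mulr0 ?normr0//.
  by rewrite (le_lt_trans _ xM)// lerDl.
move=> _ _; under eq_fun do rewrite q0.
by rewrite /Rintegral => /cvg_lim <-//; rewrite lim_cst.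
Qed.

End rV_integrals.

Section test_functions.
Context (R : realType) (n : nat).
Implicit Types (phi psi : 'rV[R]_n -> R) (A B : set 'rV[R]_n).
Local Notation leb := (lebesgue R n).

(** Off its closed support phi is locally zero, hence so are its derivatives. *)
Lemma test_function_partial A phi i :
  test_function A phi -> test_function A (partial i phi).
Proof.
move=> [Ckphi cphi phiA].
have sub : closure [set x | partial i phi x != 0] `<=` closure [set x | phi x != 0].
  rewrite [X in _ `<=` X](closure_id _).1; last exact: closed_closure.
  apply: closureS => x /= dx; apply: contrapT => nx.
  have : nbhs x (~` closure [set x | phi x != 0]).
    by apply: open_nbhs_nbhs; split => //; apply: closed_openC; exact: closed_closure.
  move=> nbx; move/eqP: dx; apply; rewrite /partial.
  rewrite (@near_eq_derive R _ _ phi (cst 0) x (delta_mx ord0 i)) ?derive_cst//.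
  apply: filterS nbx => y /=; apply: contra_notP => /eqP phiy.
  exact: subset_closure.
split.
- by move=> k; have [_ /(_ i)[]] := Ckphi k.+1.
- by apply: subclosed_compact cphi sub; exact: closed_closure.
- exact: subset_trans phiA.
Qed.

Lemma test_functionS A B phi : A `<=` B -> test_function A phi -> test_function B phi.
Proof. by move=> AB [? ? ?]; split => //; exact: subset_trans AB. Qed.

Lemma test_function_continuous A phi : test_function A phi -> continuous phi.
Proof. by move=> [/(_ 0%N)[]]. Qed.

Lemma test_function_derivable A phi i x :
  test_function A phi -> derivable phi x (delta_mx ord0 i).
Proof. by move=> [/(_ 1%N)[_ /(_ i)[]]]. Qed.

Lemma test_function_eq0 A phi x : test_function A phi -> ~ A x -> phi x = 0.
Proof.
move=> [_ _ phiA]; apply: contra_notP => /eqP phix.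
by apply: phiA; exact: subset_closure.
Qed.

Lemma test_function_support A phi : test_function A phi ->
  exists M : R, forall x, M < `|x| -> phi x = 0.
Proof.
move=> [_ /compact_bounded[M [_ HM]] _]; exists (M + 1) => x Mx.
apply: contrapT => /eqP phix.
have M1 : M < M + 1 by rewrite ltrDl.
have cx : closure [set x | phi x != 0] x by exact: subset_closure.
by have /= := HM (M + 1) M1 x cx; rewrite leNgt Mx.
Qed.

Lemma test_function_bounded A phi : test_function A phi ->
  exists2 C : R, 0 <= C & forall x, `|phi x| <= C.
Proof.
move=> tphi; have [M phiM] := test_function_support tphi.
exact: continuous_bounded_support (test_function_continuous tphi) phiM.
Qed.

Lemma test_function_measurable A phi :
  test_function A phi -> measurable_fun setT phi.
Proof. by move=> /test_function_continuous/continuous_measurable_rV. Qed.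

Lemma test_function_integrable A phi D :
  measurable D -> test_function A phi -> leb.-integrable D (EFin \o phi).
Proof.
move=> mD tphi; have [M phiM] := test_function_support tphi.
have [C _ phiC] := test_function_bounded tphi.
exact: (integrable_bounded_support mD (test_function_measurable tphi) phiC phiM).
Qed.

Lemma test_function_integrableM A B phi psi D : measurable D ->
  test_function A phi -> test_function B psi ->
  leb.-integrable D (EFin \o (phi \* psi)).
Proof.
move=> mD tphi tpsi; have [M phiM] := test_function_support tphi.
have [C C0 phiC] := test_function_bounded tphi.
have [C' C'0 psiC] := test_function_bounded tpsi.
apply: (@integrable_bounded_support _ _ _ (C * C') M) => //.
- apply: measurable_funM; first exact: test_function_measurable tphi.
  exact: test_function_measurable tpsi.
- by move=> x; rewrite normrM ler_pM.
- by move=> x /phiM /= ->; rewrite mul0r.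
Qed.

Lemma test_function_L1loc A B phi : measurable A -> test_function B phi -> L1loc A phi.
Proof.
move=> mA tphi; split.
  by apply: (measurable_funS measurableT) => //; exact: test_function_measurable tphi.
move=> K cK _; apply: test_function_integrable tphi; exact: compact_measurable_rV.
Qed.

Lemma test_function_by_parts B C phi psi i :
  test_function B phi -> test_function C psi ->
  \int[leb]_x (phi x * partial i psi x) = - \int[leb]_x (partial i phi x * psi x).
Proof.
move=> tphi tpsi; apply/eqP; rewrite -subr_eq0 opprK; apply/eqP.
have tdphi := test_function_partial i tphi.
have tdpsi := test_function_partial i tpsi.
rewrite -RintegralD//; last 2 first.
- exact: test_function_integrableM tphi tdpsi.
- exact: test_function_integrableM tdphi tpsi.
have E x : 'D_(delta_mx ord0 i) (phi * psi) x =
    phi x * partial i psi x + partial i phi x * psi x.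
  rewrite deriveM; [|exact: test_function_derivable tphi|exact: test_function_derivable tpsi].
  by rewrite /partial [X in _ + X]mulrC.
have [M phiM] := test_function_support tphi.
under eq_Rintegral do rewrite -E.
have cM (f g : 'rV[R]_n -> R) : continuous f -> continuous g ->
    continuous (fun x : 'rV[R]_n => f x * g x : R).
  move=> cf cg x; have H := @cvgM R _ (nbhs x) _ f g _ _ (cf x) (cg x); exact: H.
have cphi := test_function_continuous tphi.
have cpsi := test_function_continuous tpsi.
apply: (@Rintegral_derive_eq0 _ _ _ _ M).
- exact: cM.
- by move=> x; apply: derivableM; [exact: test_function_derivable tphi|exact: test_function_derivable tpsi].
- under eq_fun do rewrite E.
  have c1 := cM _ _ cphi (test_function_continuous tdpsi).
  have c2 := cM _ _ (test_function_continuous tdphi) cpsi.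
  move=> x; have H := @cvgD R _ _ (nbhs x) _ _ _ _ _ (c1 x) (c2 x); exact: H.
- by move=> x /phiM phix; transitivity (phi x * psi x) => //; rewrite phix mul0r.
Qed.

(** The weak formulation asks for phi in W_0^{1,2} and for a weak gradient of phi on the whole
    space; the classical partial derivatives serve for both. *)
Lemma test_function_weak_gradient A B phi : measurable A -> test_function B phi ->
  weak_gradient A phi (fun i => partial i phi).
Proof.
move=> mA tphi; split; first exact: test_function_L1loc tphi.
move=> i; have tdphi := test_function_partial i tphi.
split; first exact: test_function_L1loc tdphi.
move=> psi tpsi; have tdpsi := test_function_partial i tpsi.
have restr f g : test_function A g ->
    \int[leb]_(x in A) (f x * g x) = \int[leb]_x (f x * g x).
  move=> tg; rewrite Rintegral_mkcond; apply: eq_Rintegral => x _.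
  rewrite /patch; case: ifPn => //; rewrite notin_setE => nAx.
  by rewrite (test_function_eq0 tg nAx) mulr0.
by rewrite !restr//; exact: test_function_by_parts tphi tpsi.
Qed.

Lemma weak_gradient0 A : measurable A ->
  weak_gradient A (fun=> 0 : R) (fun (_ : 'I_n) _ => 0).
Proof.
have L0 : measurable A -> L1loc A (fun=> 0 : R).
  by move=> mA; split => // K cK _; exact: integrable0.
move=> mA; split; first exact: L0.
move=> i; split; first exact: L0.
move=> psi _; under eq_Rintegral do rewrite mul0r.
under [in RHS]eq_Rintegral do rewrite mul0r.
by rewrite /Rintegral integral0 oppr0.
Qed.

Lemma W12_sqnorm0 A : W12_sqnorm A (fun=> 0 : R) (fun (_ : 'I_n) _ => 0) = 0%E.
Proof.
by rewrite /W12_sqnorm expr0n /= integral0 add0e big1.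
Qed.

Lemma test_function_W12_0 A phi : measurable A -> test_function A phi -> W12_0 A phi.
Proof.
move=> mA tphi; split.
- exists (fun i => partial i phi); first exact: test_function_weak_gradient tphi.
  have fin f : test_function A f ->
      (\int[leb]_(x in A) (f x ^+ 2)%:E < +oo)%E.
    move=> tf; have := test_function_integrableM mA tf tf.
    move=> /integrable_lty; rewrite /= => /(_ mA).
    by under eq_integral do rewrite -expr2.
  rewrite /W12_sqnorm lte_add_pinfty//; first exact: fin.
  apply/lte_sum_pinfty => i _; apply: fin.
  exact: test_function_partial.
- by move=> x; exact: test_function_eq0.
(* phi is its own approximation: the difference is identically zero. *)
- move=> e e0; exists phi, (fun _ _ => 0).
  have -> : phi \- phi = fun=> 0 by apply/funext => x /=; rewrite subrr.
  split => //; first exact: weak_gradient0.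
  by rewrite W12_sqnorm0 lte_fin.
Qed.

End test_functions.

(** * A smooth bump function *)

Section bump1.
Context (R : realType).
Implicit Types (P : {poly R}) (t : R).

Lemma is_derive_quadratic (f : R -> R) (t C : R) :
  (forall h, `|f (t + h) - f t| <= C * h ^+ 2) -> is_derive t 1 f 0.
Proof.
move=> fC.
have C0 : 0 <= C by have := fC 1; rewrite expr1n mulr1; apply: le_trans.
have H : (fun h : R => h^-1 *: ((f \o shift t) (h *: (1 : R)) - f t)) @ 0^' --> (0 : R).
  apply/cvgrPdist_le => e e0.
  have C1 : 0 < C + 1 by rewrite -(addr0 0) ler_ltD.
  have eC : 0 < e / (C + 1) by exact: divr_gt0.
  near=> h.
  rewrite sub0r normrN /= [h *: _]mulr1 (addrC h) normrM normfV.
  have h0 : 0 < `|h| by rewrite normr_gt0; near: h; exact: nbhs_dnbhs_neq.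
  rewrite ler_pdivrMl// (le_trans (fC h))// -real_normK ?num_real//.
  rewrite expr2 mulrCA ler_wpM2l//.
  have he : `|h| <= e / (C + 1) by near: h; exact: dnbhs0_le.
  rewrite (le_trans (ler_wpM2l C0 he))//.
  rewrite mulrA ler_pdivrMr; last lra.
  by rewrite mulrC ler_wpM2l ?lerDl// ltW.
constructor; first by apply/cvg_ex; exists 0.
exact: cvg_lim H.
Unshelve. all: by end_near. Qed.

(** Raise y/(k+1) <= exp(y/(k+1)) to the power k+1. *)
Lemma exprn_le_expR (k : nat) (y : R) : 0 <= y ->
  y ^+ k.+1 <= k.+1%:R ^+ k.+1 * expR y.
Proof.
move=> y0; have k0 : (0 : R) < k.+1%:R by rewrite ltr0n.
have -> : expR y = expR (y / k.+1%:R) ^+ k.+1.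
  by rewrite -expRM_natl mulrCA divff ?mulr1// gt_eqF.
rewrite -exprMn lerXn2r ?nnegrE ?mulr_ge0 ?expR_ge0 ?(ltW k0)//.
rewrite mulrC -ler_pdivrMr// (le_trans _ (expR_ge1Dx _))// lerDr//.
Qed.

(** The functions P(t) w^(-m) exp(-1/w), w = 1 - t^2, extended by zero. This family contains
    exp(-1/w) and is closed under differentiation. *)
Definition bump_fun P (m : nat) t : R :=
  if `|t| < 1 then P.[t] * (1 - t ^+ 2)^-1 ^+ m * expR (- (1 - t ^+ 2)^-1)
  else 0.

Lemma onem_sqr_gt0 t : `|t| < 1 -> 0 < 1 - t ^+ 2.
Proof. by move=> t1; rewrite subr_gt0 -real_normK ?num_real// expr_lt1. Qed.

(** With y = 1/w, w^(-m) exp(-1/w) = y^(m+2) exp(-y) w^2, and y^(m+2) exp(-y) is bounded. The factor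
    w^2 is the quadratic decay needed to differentiate at the ends. *)
Lemma bump_fun_le P m : exists2 C, 0 <= C & forall t,
  `|bump_fun P m t| <= C * (if `|t| < 1 then (1 - t ^+ 2) ^+ 2 else 0).
Proof.
have cP : {within `[(-1), 1 : R], continuous (fun t => `|P.[t]|)}.
  apply: continuous_subspaceT => t.
  by apply: cvg_norm; exact: continuous_horner.
have [c _ Pc] := EVT_max (ltW (lt_trans (ltrN10 R) ltr01)) cP.
pose K : R := m.+2%:R ^+ m.+2.
exists (`|P.[c]| * K); first by rewrite mulr_ge0// exprn_ge0.
move=> t; rewrite /bump_fun; case: ifPn => [t1|_]; last by rewrite normr0 mulr0.
have w0 := onem_sqr_gt0 t1; set w := 1 - t ^+ 2 in w0 *.
rewrite -mulrA normrM -mulrA ler_pM//.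
  by apply: Pc; rewrite in_itv /= -ler_norml ltW.
have y0 : 0 < w^-1 by rewrite invr_gt0.
rewrite ger0_norm ?mulr_ge0 ?expR_ge0 ?exprn_ge0 ?(ltW y0)//.
rewrite expRN ler_pdivrMr ?expR_gt0//.
have -> : w^-1 ^+ m = w^-1 ^+ m.+2 * w ^+ 2.
  by rewrite -(addn2 m) exprD -mulrA -exprMn mulVf ?gt_eqF// expr1n mulr1.
rewrite [leRHS]mulrAC ler_wpM2r ?exprn_ge0 ?(ltW w0)//.
exact: exprn_le_expR (ltW y0).
Qed.

Lemma bump_fun_bounded P m : exists2 C, 0 <= C & forall t, `|bump_fun P m t| <= C.
Proof.
have [C C0 PC] := bump_fun_le P m; exists C => // t.
rewrite (le_trans (PC t))// ler_piMr//; case: ifPn => // t1.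
by rewrite expr_le1// ?gerBl ?sqr_ge0// ltW// onem_sqr_gt0.
Qed.

(** The new numerator after differentiation: since w' = -2t, the derivative of P w^(-m) exp(-1/w) is
    w^(-m-2) exp(-1/w) times P' w^2 + P (2 m t w - 2 t). *)
Definition bump_poly P (m : nat) : {poly R} :=
  P^`() * (1 - 'X^2) ^+ 2 + P * (2%:R * m%:R *: ('X * (1 - 'X^2)) - 2%:R *: 'X).

Lemma is_derive_bump P m t :
  is_derive t 1 (bump_fun P m) (bump_fun (bump_poly P m) m.+2 t).
Proof.
have [t1|t1] := ltP `|t| 1; last first.
  have [C C0 PC] := bump_fun_le P m.
  (* As |t| >= 1, a point t + h inside the support has 1 - |t + h| <= |h|, so 1 - (t + h)^2 <= 2
     |h|; squaring gives the constant 4 * C. *)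
  rewrite {2}/bump_fun ltNge t1 /=; apply: (@is_derive_quadratic _ _ (4 * C)) => h.
  rewrite {2}/bump_fun ltNge t1 /= subr0 (le_trans (PC _))// [4 * C]mulrC -mulrA.
  rewrite ler_wpM2l//; case: ifPn => [th1|_]; last by rewrite mulr_ge0// sqr_ge0.
  have w0 := onem_sqr_gt0 th1.
  have : 1 - (t + h) ^+ 2 <= 2 * `|h|.
    have h1 : 1 - `|t + h| <= `|h|.
      have := ler_normB (t + h) h; rewrite addrK => /(le_trans t1); lra.
    rewrite -(real_normK (num_real (t + h))).
    rewrite (_ : 1 - _ = (1 - `|t + h|) * (1 + `|t + h|)); last by ring.
    rewrite mulrC ler_pM//; [by rewrite subr_ge0 ltW|lra].
  move=> wh; rewrite [leRHS](_ : _ = (2 * `|h|) ^+ 2).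
    by rewrite lerXn2r ?nnegrE ?mulr_ge0// ltW.
  by rewrite exprMn real_normK ?num_real// -natrX.
have w0 := onem_sqr_gt0 t1.
pose w (s : R) := 1 - s ^+ 2.
pose f (s : R) := P.[s] * (w s)^-1 ^+ m * expR (- (w s)^-1).
apply: (@near_eq_is_derive _ _ _ f).
  have : \forall s \near t, `|s| < 1.
    apply: open_nbhs_nbhs; split => //.
    apply: (@open_comp _ _ (@Num.norm R R) [set z : R | z < 1]).
      by move=> s _; exact: norm_continuous.
    exact: open_lt.
  by apply: filterS => s s1; rewrite /bump_fun s1.
have dw : is_derive t 1 w (- (2 * t)).
  apply: is_derive_eq; rewrite add0r mul1r ![_ *: _]mulr1; ring.
have dv : is_derive t 1 (fun s => (w s)^-1) (2 * t * (w t)^-1 ^+ 2).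
  apply: is_derive_eq; first by apply: (is_deriveV _ dw); rewrite gt_eqF.
  by rewrite [_ *: _]mulrN mulNr opprK exprVn mulrC.
have dvm : is_derive t 1 (fun s => (w s)^-1 ^+ m) (m%:R * (w t)^-1 ^+ m.-1 * (2 * t * (w t)^-1 ^+ 2)).
  by have := is_deriveX m dv; rewrite exprfctE.
have de : is_derive t 1 (fun s => expR (- (w s)^-1)) (expR (- (w t)^-1) * - (2 * t * (w t)^-1 ^+ 2)).
  exact (is_derive1_comp (is_derive_expR _) (is_deriveN dv)).
have dP : is_derive t 1 (horner P) P^`().[t] by exact: is_derive_poly.
have H := is_deriveM (is_deriveM dP dvm) de.
apply: (is_derive_eq H); rewrite /bump_fun t1.
have -> : (bump_poly P m).[t] =
    P^`().[t] * w t ^+ 2 + P.[t] * (2 * m%:R * (t * w t) - 2 * t).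
  by rewrite /bump_poly /w !hornerE /=; ring.
rewrite -/(w t).
transitivity (P.[t] * (w t)^-1 ^+ m * (expR (- (w t)^-1) * - (2 * t * (w t)^-1 ^+ 2)) +
  expR (- (w t)^-1) * (P.[t] * (m%:R * (w t)^-1 ^+ m.-1 * (2 * t * (w t)^-1 ^+ 2)) +
  (w t)^-1 ^+ m * P^`().[t])) => //.
have wt : w t * (w t)^-1 = 1 by rewrite divff ?gt_eqF.
(* For m = 0 the truncated predecessor is harmless, as the factor m kills both sides. *)
have -> : m%:R * (w t)^-1 ^+ m.-1 = m%:R * w t * (w t)^-1 ^+ m.
  by case: (m) => [|k]; rewrite ?mul0r// exprS [RHS]mulrA -(mulrA _ (w t)) wt mulr1.
have -> : (w t)^-1 ^+ m.+2 = (w t)^-1 ^+ m * (w t)^-1 ^+ 2 by rewrite -exprD addn2.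
move: (w t)^-1 wt => v wt; move: (v ^+ m) (expR _) => vm E.
have -> : vm * P^`().[t] = vm * P^`().[t] * (w t * v) ^+ 2 by rewrite wt expr1n mulr1.
ring.
Qed.

Fixpoint bump_polys (k : nat) : {poly R} :=
  if k is k'.+1 then bump_poly (bump_polys k') (2 * k') else 1.

(** The k-th derivative of exp(-1/(1-t^2)) extended by zero; each differentiation raises the
    exponent of 1/w by 2. *)
Definition bump k t := bump_fun (bump_polys k) (2 * k) t.

Lemma is_derive_bumpk k t : is_derive t 1 (bump k) (bump k.+1 t).
Proof. by have := is_derive_bump (bump_polys k) (2 * k) t; rewrite /bump mulnS. Qed.

Lemma bump_bounded k : exists2 C, 0 <= C & forall t, `|bump k t| <= C.
Proof. exact: bump_fun_bounded. Qed.

Lemma bump_eq0 k t : 1 <= `|t| -> bump k t = 0.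
Proof. by move=> t1; rewrite /bump /bump_fun ltNge t1. Qed.

Lemma bump0E t : `|t| < 1 -> bump 0 t = expR (- (1 - t ^+ 2)^-1).
Proof. by move=> t1; rewrite /bump /bump_fun t1 muln0 expr0 mulr1 hornerE mul1r. Qed.

Lemma bump0_ge0 t : 0 <= bump 0 t.
Proof.
have [/bump0E ->|/bump_eq0 -> //] := ltP `|t| 1; exact: expR_ge0.
Qed.

Lemma bump0_gt0 t : `|t| < 1 -> 0 < bump 0 t.
Proof. by move=> /bump0E ->; exact: expR_gt0. Qed.

Lemma bump0_le1 t : bump 0 t <= 1.
Proof.
have [t1|/bump_eq0 -> //] := ltP `|t| 1.
by rewrite bump0E// expR_le1 oppr_le0 invr_ge0 ltW// onem_sqr_gt0.
Qed.

(* Near the ends of its support the bump function is convex. *)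
Lemma bump2_ge t : - bump 2 t <= 162%:R * bump 0 t.
Proof.
have [t1|t1] := ltP `|t| 1; last by rewrite !bump_eq0// oppr0 mulr0.
have w0 := onem_sqr_gt0 t1; rewrite bump0E// /bump /bump_fun t1.
rewrite -[leLHS]mulNr ler_pM2r ?expR_gt0// -[leLHS]mulNr.
have -> : (bump_polys 2).[t] = 4 - 12 * (1 - t ^+ 2) + 6 * (1 - t ^+ 2) ^+ 2.
  have p1 : bump_poly (1 : {poly R}) (2 * 0) = (- 2%:R) *: 'X.
    by rewrite /bump_poly derivC mul0r add0r mul1r muln0 mulr0 scale0r sub0r scaleNr.
  by rewrite /= p1 /bump_poly derivZ derivX muln1 !hornerE /=; ring.
have w1 : 1 - t ^+ 2 <= 1 by rewrite gerBl sqr_ge0.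
move: w0 w1; set w := 1 - t ^+ 2 => w0 w1.
rewrite exprVn ler_pdivrMr ?exprn_gt0//.
have w4 : w ^+ (2 * 2) = w ^+ 2 * w ^+ 2 by rewrite -exprD.
rewrite w4; have w2 : 0 <= w ^+ 2 by exact: sqr_ge0.
have w4_ge0 : 0 <= w ^+ 2 * w ^+ 2 by exact: mulr_ge0.
(* For w <= 1/3 the numerator 4 - 12 w + 6 w^2 is nonnegative. Otherwise it equals 6 (w - 1)^2 - 2
   >= -2 while w^4 >= 1/81, whence 162 = 2 * 81. *)
have [w3|w3] := leP w (1 / 3); first lra.
have w3' : 0 <= (w - 1 / 3) * (w + 1 / 3) by rewrite mulr_ge0//; lra.
have w9 : 1 / 9 <= w ^+ 2 by move: w3'; rewrite -subr_sqr; lra.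
have w81 : (1 / 9) * (1 / 9) <= w ^+ 2 * w ^+ 2 by rewrite ler_pM//; lra.
have : 0 <= (w - 1) ^+ 2 by exact: sqr_ge0.
rewrite sqrrB; lra.
Qed.

End bump1.

Section tensor_products.
Context (R : realType) (n : nat) (G : 'I_n -> nat -> R -> R).
Hypothesis dG : forall i k (t : R), is_derive t 1 (G i k) (G i k.+1 t).

(** [k] is a multi-index: since [G i k] is the k-th derivative of [G i 0], a partial derivative only
    increments one entry, and smoothness follows by induction over all multi-indices at once. *)
Definition tensor (k : 'I_n -> nat) (x : 'rV[R]_n) : R :=
  \prod_i G i (k i) (x ord0 i).

Let cG i k : continuous (G i k).
Proof. by move=> t; apply/differentiable_continuous/derivable1_diffP; case: (dG i k t). Qed.

Lemma tensor_continuous k : continuous (tensor k).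
Proof.
suff H (s : seq 'I_n) : continuous (fun x : 'rV[R]_n => \prod_(i <- s) G i (k i) (x ord0 i)).
  exact: H.
elim: s => [|i s IH].
  by under eq_fun do rewrite big_nil; exact: cst_continuous.
under eq_fun do rewrite big_cons.
have ci : continuous (fun x : 'rV[R]_n => G i (k i) (x ord0 i)).
  move=> x; apply: (@continuous_comp _ _ _ (fun x : 'rV[R]_n => x ord0 i) (G i (k i))).
    exact: coord_continuous.
  exact: cG.
move=> x; have H := @cvgM R _ (nbhs x) _ _ _ _ _ (ci x) (IH x); exact: H.
Qed.

Lemma is_derive_tensor k j (x : 'rV[R]_n) :
  is_derive x (delta_mx ord0 j) (tensor k) (tensor (fun i => k i + (i == j))%N x).
Proof.
pose p := \prod_(i | i != j) G i (k i) (x ord0 i).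
have tE (h : R) : tensor k (h *: delta_mx ord0 j + x) = p * G j (k j) (h + x ord0 j).
  rewrite /tensor (bigD1 j)//= mulrC !mxE !eqxx mulr1; congr (_ * _).
  apply: eq_bigr => i ij; rewrite !mxE eqxx /= (negbTE ij) mulr0 add0r//.
have tE0 : tensor k x = p * G j (k j) (x ord0 j).
  by have := tE 0; rewrite scale0r !add0r.
have -> : tensor (fun i => k i + (i == j))%N x = p * G j (k j).+1 (x ord0 j).
  rewrite /tensor (bigD1 j)//= eqxx addn1 mulrC; congr (_ * _).
  by apply: eq_bigr => i /negbTE ->; rewrite addn0.
have E : (fun h : R => h^-1 *: ((tensor k \o shift x) (h *: delta_mx ord0 j) - tensor k x))
   = (fun h : R => p * (h^-1 *: ((G j (k j) \o shift (x ord0 j)) (h *: (1 : R)) - G j (k j) (x ord0 j)))).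
  apply/funext => h /=; rewrite tE tE0 -mulrBr [h *: _]mulr1.
  by rewrite /GRing.scale /= mulrCA.
have H : (fun h : R => h^-1 *: ((tensor k \o shift x) (h *: delta_mx ord0 j) - tensor k x))
    @ 0^' --> p * G j (k j).+1 (x ord0 j).
  rewrite E; apply: cvgM; first exact: cvg_cst.
  have [dg <-] := dG j (k j) (x ord0 j); exact: dg.
constructor; first by apply/cvg_ex; exists (p * G j (k j).+1 (x ord0 j)).
exact: cvg_lim H.
Qed.

Lemma partial_tensor k j : partial j (tensor k) = tensor (fun i => k i + (i == j))%N.
Proof. by apply/funext => x; rewrite /partial; have [_ ->] := is_derive_tensor k j x. Qed.

Lemma tensor_Ck m k : Ck m (tensor k).
Proof.
elim: m k => [|m IH] k; split => //; try exact: tensor_continuous.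
move=> i; split; first by move=> x; have [] := is_derive_tensor k i x.
by rewrite partial_tensor.
Qed.

End tensor_products.

(* a, b and c are the values of each factor at x + z, x - z and x. *)
Lemma prod_second_difference (R : realFieldType) (I : Type) (s : seq I)
    (a b c : I -> R) (L B m : R) : 0 <= L -> 0 <= B -> 0 <= m ->
  (forall i, 0 <= a i <= 1) -> (forall i, 0 <= b i <= 1) -> (forall i, 0 <= c i <= 1) ->
  (forall i, `|a i - c i| <= L * m) -> (forall i, `|b i - c i| <= L * m) ->
  (forall i, `|a i + b i - 2 * c i| <= B * m ^+ 2) ->
  `|\prod_(i <- s) a i + \prod_(i <- s) b i - 2 * \prod_(i <- s) c i| <=
    ((size s)%:R * B + 2 * (size s)%:R ^+ 2 * L ^+ 2) * m ^+ 2.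
Proof.
move=> L0 B0 m0 a01 b01 c01 ac bc abc.
have norm1 (x : R) : 0 <= x <= 1 -> `|x| <= 1 by move=> /andP[x0 x1]; rewrite ger0_norm.
have prod1 (s' : seq I) (f : I -> R) : (forall i, 0 <= f i <= 1) ->
    `|\prod_(i <- s') f i| <= 1.
  move=> f01; apply: norm1; elim/big_ind: _ => //; first by rewrite ler01 lexx.
  by move=> x y /andP[x0 x1] /andP[y0 y1]; rewrite mulr_ge0//= mulr_ile1.
have diff (s' : seq I) (f : I -> R) :
    (forall i, 0 <= f i <= 1) -> (forall i, `|f i - c i| <= L * m) ->
    `|\prod_(i <- s') f i - \prod_(i <- s') c i| <= (size s')%:R * (L * m).
  move=> f01 fc; elim: s' => [|i s' IH]; first by rewrite !big_nil subrr normr0 mul0r.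
  rewrite !big_cons /=.
  rewrite (_ : f i * _ - _ = (f i - c i) * \prod_(j <- s') f j +
    c i * (\prod_(j <- s') f j - \prod_(j <- s') c j)); last by ring.
  rewrite (le_trans (ler_normD _ _))// !normrM -natr1 mulrDl mul1r addrC lerD//.
    by rewrite (le_trans _ IH)// ler_piMl// norm1.
  by rewrite (le_trans _ (fc i))// ler_piMr// prod1.
elim: s => [|i s IH].
  rewrite !big_nil (_ : 1 + 1 - 2 * 1 = 0); last by ring.
  by rewrite normr0 !mulr_ge0 ?addr_ge0 ?mulr_ge0 ?sqr_ge0.
rewrite !big_cons /=.
set A := \prod_(j <- s) a j in IH *; set D := \prod_(j <- s) b j in IH *.
set C := \prod_(j <- s) c j in IH *.
have dA : `|A - C| <= (size s)%:R * (L * m) by exact: diff.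
have dD : `|D - C| <= (size s)%:R * (L * m) by exact: diff.
(* Leibniz rule for second differences: the second difference of either factor, plus products of
   first differences, each of order m^2. *)
rewrite (_ : _ - _ = c i * (A + D - 2 * C) + C * (a i + b i - 2 * c i) +
  ((a i - c i) * (A - C) + (b i - c i) * (D - C))); last by ring.
set k := (size s)%:R in IH dA dD *.
have k0 : 0 <= k by exact: ler0n.
have -> : (size s).+1%:R = k + 1 by rewrite natr1.
have e1 : `|c i * (A + D - 2 * C)| <= (k * B + 2 * k ^+ 2 * L ^+ 2) * m ^+ 2.
  by rewrite normrM (le_trans _ IH)// ler_piMl// norm1.
have e2 : `|C * (a i + b i - 2 * c i)| <= B * m ^+ 2.
  by rewrite normrM (le_trans _ (abc i))// ler_piMl// prod1.
have e3 : `|(a i - c i) * (A - C)| <= (L * m) * (k * (L * m)).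
  by rewrite normrM ler_pM.
have e4 : `|(b i - c i) * (D - C)| <= (L * m) * (k * (L * m)).
  by rewrite normrM ler_pM.
rewrite (le_trans (ler_normD _ _))//.
apply: (le_trans (lerD (le_trans (ler_normD _ _) (lerD e1 e2)) (le_trans (ler_normD _ _) (lerD e3 e4)))).
(* Since (k+1)^2 - k^2 - k = k + 1, the claimed bound exceeds the sum of the four estimates by 2
   (k+1) (L m)^2. *)
have k1 : 0 <= (k + 1) * (L * m) ^+ 2 by rewrite mulr_ge0 ?sqr_ge0// addr_ge0.
rewrite -subr_ge0 [leRHS](_ : _ = 2 * ((k + 1) * (L * m) ^+ 2)); first lra.
by ring.
Qed.

Section bumpn.
Context (R : realType) (n : nat) (c : 'rV[R]_n) (rho : R).
Hypothesis rho_gt0 : 0 < rho.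

(** The chain-rule factor [rho^-1 ^+ k] makes this the k-th derivative of the rescaled profile. *)
Definition bump_coord (i : 'I_n) (k : nat) (t : R) : R :=
  rho^-1 ^+ k * bump k ((t - c ord0 i) / rho).

Lemma is_derive_bump_coord i k (t : R) :
  is_derive t (1 : R) (bump_coord i k) (bump_coord i k.+1 t).
Proof.
have d1 : is_derive t (1 : R) (fun t : R => (t - c ord0 i) / rho) rho^-1.
  by apply: is_derive_eq; rewrite scaler0 add0r subr0 [_ *: _]mulr1.
have d2 := @is_derive1_comp R (@bump R k) (fun t : R => (t - c ord0 i) / rho) t _ _
  (is_derive_bumpk k ((t - c ord0 i) / rho)) d1.
have d3 := is_deriveZ (rho^-1 ^+ k) d2.
apply: (is_derive_eq d3).
by rewrite /bump_coord exprSr -mulrA; congr (_ * _); rewrite mulrC.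
Qed.

Definition bumpn : 'rV[R]_n -> R := tensor bump_coord (fun=> 0%N).

Lemma bump_coord0_itv i t : 0 <= bump_coord i 0 t <= 1.
Proof. by rewrite /bump_coord expr0 mul1r bump0_ge0 bump0_le1. Qed.

Lemma bumpn_ge0 x : 0 <= bumpn x.
Proof. by apply: prodr_ge0 => i _; have /andP[] := bump_coord0_itv i (x ord0 i). Qed.

Lemma bumpn_le1 x : bumpn x <= 1.
Proof. by apply: prodr_ile1 => i _; exact: bump_coord0_itv. Qed.

Lemma bumpn_gt0 x : `|x - c| < rho -> 0 < bumpn x.
Proof.
move=> xc; apply: prodr_gt0 => i _; rewrite /bump_coord expr0 mul1r.
apply: bump0_gt0; rewrite normrM normfV (gtr0_norm rho_gt0) ltr_pdivrMr// mul1r.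
by have := le_lt_trans (normr_coord_le (x - c) i) xc; rewrite !mxE.
Qed.

Lemma bumpn_eq0 x : rho <= `|x - c| -> bumpn x = 0.
Proof.
move=> xc.
have [i ric] : exists i, rho <= `|x ord0 i - c ord0 i|.
  apply: contrapT => /forallNP H.
  have : `|x - c| < rho.
    by apply: rV_norm_lt => // i; rewrite !mxE ltNge; apply/negP/H.
  by rewrite ltNge xc.
rewrite /bumpn /tensor (bigD1 i)//= /bump_coord expr0 mul1r bump_eq0 ?mul0r//.
by rewrite normrM normfV (gtr0_norm rho_gt0) ler_pdivlMr// mul1r.
Qed.

Lemma bumpn_test_function : test_function [set x | `|x - c| <= rho] bumpn.
Proof.
have cl := @closed_rV_closed_ball R n c rho.
have sub : closure [set x | bumpn x != 0] `<=` [set x | `|x - c| <= rho].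
  rewrite [X in _ `<=` X](closure_id _).1//; apply: closureS => x /=.
  by apply: contraNT => xc; rewrite bumpn_eq0// ltW// ltNge.
split => //; first by move=> k; apply: tensor_Ck => *; exact: is_derive_bump_coord.
apply: subclosed_compact sub; first exact: closed_closure.
exact: compact_rV_closed_ball.
Qed.

(** Each pure second derivative is the one-variable one times the remaining factors, which are
    nonnegative, so [bump2_ge] applies coordinatewise. *)
Lemma bumpn_laplacian : exists2 C, 0 <= C &
  forall x, - (\sum_i partial i (partial i bumpn) x) <= C * bumpn x.
Proof.
exists (n%:R * (rho^-1 ^+ 2 * 162)).
  by rewrite mulr_ge0// mulr_ge0// sqr_ge0.
move=> x; rewrite -sumrN.
have le1 i : - partial i (partial i bumpn) x <= rho^-1 ^+ 2 * 162 * bumpn x.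
  rewrite /bumpn !(partial_tensor is_derive_bump_coord).
  pose p := \prod_(j < n | j != i) bump_coord j 0 (x ord0 j).
  have -> : tensor bump_coord (fun=> 0%N) x = bump_coord i 0 (x ord0 i) * p.
    by rewrite /tensor (bigD1 i).
  have -> : tensor bump_coord (fun j => 0 + (j == i) + (j == i))%N x =
      bump_coord i 2 (x ord0 i) * p.
    rewrite /tensor (bigD1 i)//= eqxx; congr (_ * _).
    by apply: eq_bigr => j /negbTE ->.
  have p0 : 0 <= p.
    by apply: prodr_ge0 => j _; have /andP[] := bump_coord0_itv j (x ord0 j).
  rewrite /bump_coord expr0 mul1r -mulNr mulrA ler_wpM2r//.
  by rewrite -mulrN -mulrA ler_wpM2l ?sqr_ge0//; exact: bump2_ge.
rewrite (le_trans (ler_sum _ (fun i _ => le1 i)))// sumr_const card_ord.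
by rewrite -[leLHS]mulr_natl !mulrA.
Qed.

(** The quadratic order in z compensates the singularity |z|^(-n-2s) of the kernel when s < 1. *)
Lemma bumpn_second_difference : exists2 C, 0 <= C & forall x z,
  `|bumpn (x + z) + bumpn (x - z) - 2 * bumpn x| <= C * `|z| ^+ 2.
Proof.
have [L0 L0_ge0 HL] := bump_bounded R 1.
have [B0 B0_ge0 HB] := bump_bounded R 2.
pose L := rho^-1 * L0; pose B := rho^-1 ^+ 2 * B0.
have L_ge0 : 0 <= L by rewrite mulr_ge0// invr_ge0 ltW.
have B_ge0 : 0 <= B by rewrite mulr_ge0// sqr_ge0.
have bL i t : `|bump_coord i 1 t| <= L.
  rewrite /bump_coord expr1 normrM normfV (gtr0_norm rho_gt0) ler_wpM2l//.
  by rewrite invr_ge0 ltW.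
have bB i t : `|bump_coord i 2 t| <= B.
  by rewrite /bump_coord normrM ger0_norm ?sqr_ge0// ler_wpM2l// sqr_ge0.
have lip k i (K : R) : (forall t, `|bump_coord i k.+1 t| <= K) ->
    forall t s, `|bump_coord i k t - bump_coord i k s| <= K * `|t - s|.
  move=> bK t s; wlog ts : s t / s <= t.
    move=> H; have /orP[|] := le_total s t; first exact: H.
    by move=> /H; rewrite distrC (distrC s).
  have [|e _ ->] := @MVT_segment R (bump_coord i k) (bump_coord i k.+1) s t ts
     (fun u _ => is_derive_bump_coord i k u).
    apply: derivable_within_continuous => u _.
    by have [] := is_derive_bump_coord i k u.
  by rewrite normrM ler_wpM2r.
have snd i t h : `|bump_coord i 0 (t + h) + bump_coord i 0 (t - h) - 2 * bump_coord i 0 t| <= 2 * B * h ^+ 2.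
  wlog h0 : h / 0 <= h.
    move=> H; have /orP[|h0] := le_total 0 h; first exact: H.
    by have := H (- h); rewrite opprK sqrrN [X in `|X - _|]addrC; apply; rewrite oppr_ge0.
  have mvt (u v : R) : u <= v -> exists2 e, e \in `[u, v] &
      bump_coord i 0 v - bump_coord i 0 u = bump_coord i 1 e * (v - u).
    move=> uv; apply: MVT_segment => //.
      by move=> e _; exact: is_derive_bump_coord.
    apply: derivable_within_continuous => e _.
    by have [] := is_derive_bump_coord i 0 e.
  (* The mean value theorem on [t, t + h] and on [t - h, t], then between the two intermediate
     points, which are at most 2h apart. *)
  have [|e1 + E1] := mvt t (t + h); first by rewrite lerDl.
  have [|e2 + E2] := mvt (t - h) t; first by rewrite gerBl.
  rewrite !in_itv /= => /andP[e2l e2r] /andP[e1l e1r].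
  rewrite (_ : _ - _ = (bump_coord i 1 e1 - bump_coord i 1 e2) * h); last first.
    rewrite mulrBl; move: E1 E2; rewrite addrAC subrr add0r subKr; lra.
  rewrite normrM (ger0_norm h0) expr2 mulrA ler_wpM2r//.
  rewrite (le_trans (lip _ _ _ (bB i) _ _))//.
  rewrite (_ : 2 * B * h = B * (2 * h)); last by ring.
  by rewrite ler_wpM2l// ler_norml; apply/andP; lra.
have B2 : 0 <= 2 * B by exact: mulr_ge0.
exists (n%:R * (2 * B) + 2 * n%:R ^+ 2 * L ^+ 2).
  have n0 : 0 <= n%:R :> R by exact: ler0n.
  have n2 : 0 <= 2 * n%:R ^+ 2 :> R by rewrite mulr_ge0// exprn_ge0.
  by apply: addr_ge0; apply: mulr_ge0 => //; exact: exprn_ge0.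
move=> x z.
have := @prod_second_difference R _ (index_enum 'I_n)
  (fun i => bump_coord i 0 ((x + z) ord0 i)) (fun i => bump_coord i 0 ((x - z) ord0 i))
  (fun i => bump_coord i 0 (x ord0 i)) L (2 * B) `|z|.
have -> : size (index_enum 'I_n) = n by rewrite -[RHS]size_enum_ord enumT.
apply => //.
- by move=> i; exact: bump_coord0_itv.
- by move=> i; exact: bump_coord0_itv.
- by move=> i; exact: bump_coord0_itv.
- move=> i; rewrite (le_trans (lip _ _ _ (bL i) _ _))// ler_wpM2l//.
  by rewrite !mxE addrAC subrr add0r normr_coord_le.
- move=> i; rewrite (le_trans (lip _ _ _ (bL i) _ _))// ler_wpM2l//.
  by rewrite !mxE addrAC subrr add0r normrN normr_coord_le.
- move=> i; rewrite !mxE (le_trans (snd _ _ _))// ler_wpM2l//.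
  by rewrite -[leLHS]real_normK ?num_real// lerXn2r ?nnegrE// normr_coord_le.
Qed.

End bumpn.

(** * The kernel of the fractional Laplacian *)

Section euclidean_norm.
Context (R : realType) (n : nat).
Implicit Types x z : 'rV[R]_n.

Lemma enorm_ge0 z : 0 <= enorm z.
Proof. exact: sqrtr_ge0. Qed.

Lemma enormN z : enorm (- z) = enorm z.
Proof. by congr Num.sqrt; apply: eq_bigr => i _; rewrite mxE sqrrN. Qed.

Lemma norm_le_enorm z : `|z| <= enorm z.
Proof.
apply: rV_norm_le => [|i]; first exact: enorm_ge0.
rewrite -sqrtr_sqr ler_wsqrtr// (bigD1 i)//= lerDl.
by apply: sumr_ge0 => j _; exact: sqr_ge0.
Qed.

Lemma enorm_le z : enorm z <= n%:R * `|z|.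
Proof.
have nz : 0 <= n%:R * `|z| by rewrite mulr_ge0.
rewrite -(ger0_norm nz) -sqrtr_sqr ler_wsqrtr//.
apply: (@le_trans _ _ (\sum_(i < n) `|z| ^+ 2)).
  apply: ler_sum => i _; rewrite -[leLHS]real_normK ?num_real//.
  by rewrite lerXn2r ?nnegrE// normr_coord_le.
rewrite sumr_const card_ord -[leLHS]mulr_natl exprMn ler_wpM2r ?sqr_ge0//.
by rewrite -natrX ler_nat; case: (n) => // m; rewrite expnS leq_pmulr.
Qed.

Lemma measurable_enorm : measurable_fun setT (@enorm R n).
Proof.
apply: (@measurableT_comp _ _ _ _ _ _ (@Num.sqrt R)).
  by apply: continuous_measurable_fun; exact: sqrt_continuous.
apply: measurable_sum => i; apply: measurable_funX.
exact: measurable_rV_coord.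
Qed.

End euclidean_norm.

(** * Dyadic summation of masses of annuli *)

Section dyadic.
Context (R : realType) (T : R -> R -> R) (C beta : R).
Hypothesis T_add : forall a b c, 0 < a -> a <= b -> b <= c -> T a c = T a b + T b c.
Hypothesis T_le : forall a, 0 < a -> T a (2 * a) <= C * a `^ beta.
Hypothesis C_ge0 : 0 <= C.

Let T_diag a : 0 < a -> T a a = 0.
Proof. by move=> a0; have := T_add a0 (lexx a) (lexx a); lra. Qed.

(** A geometric series over the shells [a, 2a]. The constant D = C/(1 - 2^beta) solves C + D 2^beta
    = D, so the induction closes with a bound uniform in N. *)
Lemma dyadic_far N a : beta < 0 -> 0 < a ->
  T a (2 ^+ N * a) <= C / (1 - 2 `^ beta) * a `^ beta.
Proof.
move=> b0; have q1 : 2 `^ beta < 1.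
  by rewrite /powR gt_eqF// expR_lt1 pmulr_llt0// ln_gt0// ltr1n.
have D0 : 0 <= C / (1 - 2 `^ beta) by rewrite divr_ge0// subr_ge0 ltW.
elim: N a => [|N IH] a a0.
  by rewrite expr0 mul1r T_diag// mulr_ge0// powR_ge0.
have a2 : a <= 2 * a by lra.
have N1 : 2 * a <= 2 ^+ N.+1 * a.
  by rewrite ler_wpM2r ?(ltW a0)// exprS ler_peMr// exprn_ege1// ler1n.
rewrite (T_add a0 a2 N1).
have a2p : 0 < 2 * a by rewrite mulr_gt0.
have := IH _ a2p; rewrite mulrA -exprSr powRM ?(ltW a0)// => IHa.
rewrite (le_trans (lerD (T_le a0) IHa))// mulrA -mulrDl ler_wpM2r ?powR_ge0//.
have -> : C = C / (1 - 2 `^ beta) * (1 - 2 `^ beta).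
  by rewrite divfK// gt_eqF// subr_gt0.
move: (C / _) => D; rewrite mulfK; first lra.
by rewrite gt_eqF// subr_gt0.
Qed.

(** The same series towards the origin, where it converges because beta > 0; here D + C = D
    2^beta. *)
Lemma dyadic_near N b : 0 < beta -> 0 < b ->
  T (2 ^- N * b) b <= C / (2 `^ beta - 1) * b `^ beta.
Proof.
move=> b0; have q1 : 1 < 2 `^ beta.
  by rewrite /powR gt_eqF// expR_gt1 mulr_gt0// ln_gt0// ltr1n.
have D0 : 0 <= C / (2 `^ beta - 1) by rewrite divr_ge0// subr_ge0 ltW.
elim: N b => [|N IH] b bp.
  by rewrite expr0 invr1 mul1r T_diag// mulr_ge0// powR_ge0.
have b2p : 0 < b / 2 by rewrite divr_gt0.
have E : 2 ^- N.+1 * b = 2 ^- N * (b / 2).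
  by rewrite exprS invfM mulrAC mulrC (mulrC 2^-1).
have p0 : 0 < 2 ^- N * (b / 2) :> R by rewrite mulr_gt0// invr_gt0 exprn_gt0.
have l1 : 2 ^- N * (b / 2) <= b / 2.
  by rewrite ler_piMl ?(ltW b2p)// invf_le1 ?exprn_gt0// exprn_ege1// ler1n.
have l2 : b / 2 <= b by lra.
rewrite E (T_add p0 l1 l2).
have twob : 2 * (b / 2) = b by rewrite mulrC divfK.
have := T_le b2p; rewrite twob => Tb.
rewrite (le_trans (lerD (IH _ b2p) Tb))// -mulrDl.
have -> : b `^ beta = 2 `^ beta * (b / 2) `^ beta.
  by rewrite -powRM ?(ltW b2p)// twob.
rewrite mulrA ler_wpM2r ?powR_ge0//.
have q0 : 2 `^ beta - 1 != 0 by rewrite gt_eqF// subr_gt0.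
rewrite -[X in _ + X](divfK q0); move: (C / _) => D; lra.
Qed.

End dyadic.

Section fractional_kernel.
Context (R : realType) (n : nat) (s : R).
Hypothesis s_gt0 : 0 < s.
Implicit Types (a b : R) (z : 'rV[R]_n).
Local Notation leb := (lebesgue R n).
Local Notation p := (n%:R + 2 * s).

(** At the origin the inverse of 0 is 0, so the kernel vanishes there; lower bounds require z
    nonzero. *)
Definition frac_kernel z : R := (enorm z `^ p)^-1.

Let p_gt0 : 0 < p.
Proof. by rewrite ltr_wpDl// mulr_gt0. Qed.

Lemma frac_kernel_ge0 z : 0 <= frac_kernel z.
Proof. by rewrite invr_ge0 powR_ge0. Qed.

Lemma frac_kernelN z : frac_kernel (- z) = frac_kernel z.
Proof. by rewrite /frac_kernel enormN. Qed.

Lemma measurable_frac_kernel : measurable_fun setT frac_kernel.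
Proof.
rewrite (_ : frac_kernel = (fun t : R => t `^ - p) \o @enorm R n).
  by apply: measurableT_comp; [exact: measurable_powR|exact: measurable_enorm].
by apply/funext => z /=; rewrite powRN.
Qed.

Lemma frac_kernel_le a z : 0 < a -> a <= `|z| -> frac_kernel z <= (a `^ p)^-1.
Proof.
move=> a0 az; have e0 := lt_le_trans a0 (le_trans az (norm_le_enorm z)).
rewrite lef_pV2 ?posrE ?powR_gt0//; apply: ge0_ler_powR; rewrite ?nnegrE ?(ltW p_gt0) ?(ltW a0) ?(ltW e0)//.
exact: le_trans az (norm_le_enorm z).
Qed.

Lemma frac_kernel_ge b z : 0 < `|z| -> `|z| <= b ->
  ((n%:R * b) `^ p)^-1 <= frac_kernel z.
Proof.
move=> z0 zb; have e0 := lt_le_trans z0 (norm_le_enorm z).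
have eb : enorm z <= n%:R * b by rewrite (le_trans (enorm_le z))// ler_wpM2l.
have nb0 := lt_le_trans e0 eb.
rewrite lef_pV2 ?posrE ?powR_gt0//; apply: ge0_ler_powR; rewrite ?nnegrE ?(ltW p_gt0) ?(ltW nb0) ?(ltW e0)//.
Qed.

Definition annulus a b : set 'rV[R]_n := [set z | a <= `|z| < b].

Lemma measurable_annulus a b : measurable (annulus a b).
Proof.
rewrite (_ : annulus a b = (fun z => `|z|) @^-1` `[a, b[%classic).
  rewrite -[X in measurable X]setTI.
  by apply: measurable_rV_norm => //; exact: measurable_itv.
by apply/seteqP; split=> z /=; rewrite in_itv.
Qed.

(** [j] is 2 near the origin, where |z|^2 comes from the second difference, and 0 elsewhere. *)
Definition annulus_weight (j : nat) a b z : R :=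
  `|z| ^+ j * frac_kernel z * \1_(annulus a b) z.

Lemma annulus_weight_ge0 j a b z : 0 <= annulus_weight j a b z.
Proof.
by rewrite !mulr_ge0 ?exprn_ge0 ?frac_kernel_ge0// indicE ler0n.
Qed.

Lemma annulus_weight_le j a b z : 0 < a ->
  annulus_weight j a b z <= b ^+ j * (a `^ p)^-1 * \1_(annulus a b) z.
Proof.
move=> a0; rewrite /annulus_weight indicE; case: (boolP (_ \in _)) => [|_]; last by rewrite !mulr0.
rewrite inE => /andP[az zb]; rewrite !mulr1 ler_pM ?exprn_ge0 ?frac_kernel_ge0//.
  by rewrite lerXn2r ?nnegrE ?(ltW zb)// (le_trans _ (ltW zb)).
exact: frac_kernel_le.
Qed.

Lemma measurable_annulus_weight j a b : measurable_fun setT (annulus_weight j a b).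
Proof.
apply: measurable_funM.
  apply: measurable_funM; last exact: measurable_frac_kernel.
  by apply: measurable_funX; exact: measurable_rV_norm.
by apply: measurable_indic; exact: measurable_annulus.
Qed.

Lemma annulus_weight_support j a b z : b < `|z| -> annulus_weight j a b z = 0.
Proof.
move=> bz; rewrite /annulus_weight indicE memNset ?mulr0//= => /andP[_].
by rewrite ltNge (ltW bz).
Qed.

Lemma annulus_weight_bound j a b : 0 < a ->
  exists2 C, 0 <= C & forall z, `|annulus_weight j a b z| <= C.
Proof.
move=> a0; exists (`|b| ^+ j * (a `^ p)^-1).
  by rewrite mulr_ge0 ?exprn_ge0// invr_ge0 powR_ge0.
move=> z; rewrite ger0_norm ?annulus_weight_ge0//.
rewrite (le_trans (annulus_weight_le _ _ _ a0))//.
rewrite indicE; case: (boolP (_ \in _)) => [|_]; last first.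
  by rewrite mulr0 mulr_ge0 ?exprn_ge0// invr_ge0 powR_ge0.
rewrite inE => /andP[az zb].
by rewrite mulr1 ger0_norm// (le_trans _ (ltW zb)).
Qed.

Lemma integrable_annulus_weight j a b : 0 < a ->
  leb.-integrable setT (EFin \o annulus_weight j a b).
Proof.
move=> a0; have [C _ HC] := annulus_weight_bound j b a0.
apply: (integrable_bounded_support measurableT _ HC (@annulus_weight_support j a b)).
exact: measurable_annulus_weight.
Qed.

Definition annulus_mass j a b : R := \int[leb]_z annulus_weight j a b z.

Lemma annulus_mass_add j a b c : 0 < a -> a <= b -> b <= c ->
  annulus_mass j a c = annulus_mass j a b + annulus_mass j b c.
Proof.
move=> a0 ab bc; rewrite -RintegralD//; last 2 first.
- exact: integrable_annulus_weight.
- by apply: integrable_annulus_weight; exact: lt_le_trans ab.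
apply: eq_Rintegral => z _; rewrite /annulus_weight -mulrDr; congr (_ * _).
rewrite !indicE -natrD; congr (_%:R).
have memA c' d : (z \in annulus c' d) = (c' <= `|z| < d).
  by apply/idP/idP; rewrite inE.
rewrite !memA.
have [az|za] /= := leP a `|z|; have [bz|zb] /= := leP b `|z|.
- by [].
- by rewrite (lt_le_trans zb bc).
- by have := le_trans ab bz; rewrite leNgt za.
- by [].
Qed.

(** On the shell |z|^j <= (2a)^j and the kernel is at most a^(-n-2s), while the enclosing cube has
    volume (4a)^n. For s < 1 the exponent j - 2s is negative for j = 0 and positive for j = 2: the
    two dyadic regimes. *)
Lemma annulus_mass_le j a : 0 < a ->
  annulus_mass j a (2 * a) <= 2 ^+ j * 4 ^+ n * a `^ (j%:R - 2 * s).
Proof.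
move=> a0; pose D := [set z : 'rV[R]_n | `|z - 0| <= 2 * a].
have mD : measurable D by exact: measurable_rV_closed_ball.
have a20 : 0 <= 2 * a by rewrite mulr_ge0// ltW.
have lD := lebesgue_ball_le (0 : 'rV[R]_n) a20.
have Doo : (leb D < +oo)%E by rewrite (le_lt_trans lD)// ltry.
pose K : R := (2 * a) ^+ j * (a `^ p)^-1.
have K0 : 0 <= K by rewrite mulr_ge0 ?exprn_ge0// invr_ge0 powR_ge0.
have iD : leb.-integrable setT (EFin \o (\1_D : _ -> R)).
  apply: (@integrable_bounded_support R n _ 1 (2 * a)) => //.
  - by move=> z; rewrite indicE; case: (_ \in _); rewrite ?normr1 ?normr0.
  - by move=> z za; rewrite indicE memNset// /D /= subr0; apply/negP; rewrite -ltNge.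
have iKD : leb.-integrable setT (EFin \o (fun z => K * \1_D z)).
  rewrite (_ : _ \o _ = (fun z => K%:E * (EFin \o (\1_D : _ -> R)) z)%E)//.
  exact: integrableZl.
apply: (@le_trans _ _ (\int[leb]_z (K * \1_D z))).
  apply: le_Rintegral => //; first exact: integrable_annulus_weight.
  move=> z _; rewrite (le_trans (annulus_weight_le _ _ _ a0))// ler_wpM2l//.
  rewrite !indicE ler_nat; case: (boolP (z \in annulus _ _)) => //.
  rewrite inE => /andP[_ /ltW za].
  by have -> : z \in D by rewrite inE /D /= subr0.
rewrite RintegralZl// /Rintegral integral_indic// setIT.
have lD' : fine (leb D) <= (2 * (2 * a)) ^+ n.
  by rewrite -lee_fin fineK// ge0_fin_numE.
rewrite (le_trans (ler_wpM2l K0 lD'))// /K.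
have an0 : a != 0 by rewrite gt_eqF.
rewrite powRB ?an0 ?implybT// powRD ?an0 ?implybT//.
rewrite !powR_mulrn ?(ltW a0)// [2 * (2 * a)]mulrA -natrM !exprMn invfM.
have an : a ^+ n != 0 by rewrite gt_eqF// exprn_gt0.
rewrite le_eqVlt; apply/orP; left; apply/eqP.
rewrite -[RHS]mulr1 -(divff an); ring.
Qed.

End fractional_kernel.

(** * Comparison of integrals *)

Section Rintegral_ae.
Context d (T : measurableType d) (R : realType) (mu : {measure set T -> \bar R}).
Implicit Types (D : set T) (f g : T -> R).

Lemma ae_RintegralE D f : measurable D -> mu.-integrable D (EFin \o f) ->
  {ae mu, forall x, D x -> 0 <= f x} ->
  \int[mu]_(x in D) f x = fine (\int[mu]_(x in D) `|(f x)%:E|)%E.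
Proof.
move=> mD fi f0; congr fine; have mf := measurable_int mu fi.
apply: ae_eq_integral => //; first exact: measurableT_comp.
by apply: filterS f0 => x f0 Dx; rewrite /= ger0_norm// f0.
Qed.

Lemma ae_Rintegral_ge0 D f : measurable D -> mu.-integrable D (EFin \o f) ->
  {ae mu, forall x, D x -> 0 <= f x} -> 0 <= \int[mu]_(x in D) f x.
Proof.
move=> mD fi f0; rewrite ae_RintegralE//; apply: fine_ge0.
by apply: integral_ge0 => x _; exact: abse_ge0.
Qed.

Lemma ae_le_Rintegral D f g : measurable D -> mu.-integrable D (EFin \o f) ->
  mu.-integrable D (EFin \o g) -> {ae mu, forall x, D x -> f x <= g x} ->
  \int[mu]_(x in D) f x <= \int[mu]_(x in D) g x.
Proof.
move=> mD fi gi fg; rewrite -subr_ge0 -RintegralB//; apply: ae_Rintegral_ge0 => //.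
  rewrite (_ : _ \o _ = (EFin \o g) \- (EFin \o f))%E//; exact: integrableB.
by apply: filterS fg => x fg Dx; rewrite subr_ge0 fg.
Qed.

(** The integral is the difference of those of the positive and negative parts, finite only if both
    are. Otherwise it is infinite, by convention also for oo - oo, and [fine] sends it to 0. *)
Lemma Rintegral_non_integrable D f : measurable D -> measurable_fun D f ->
  ~ mu.-integrable D (EFin \o f) -> \int[mu]_(x in D) f x = 0.
Proof.
move=> mD mf nfi; rewrite /Rintegral.
set I := (\int[mu]_(x in D) _)%E.
have [fI|] := boolP (I \is a fin_num); last by case: I => [r||].
exfalso; apply: nfi; apply/integrableP; split; first exact/measurable_EFinP.
have mE : measurable_fun D (EFin \o f) by exact/measurable_EFinP.
have Ip : (0 <= \int[mu]_(x in D) (EFin \o f)^\+ x)%E by apply: integral_ge0 => x _.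
have In : (0 <= \int[mu]_(x in D) (EFin \o f)^\- x)%E by apply: integral_ge0 => x _.
have -> : (\int[mu]_(x in D) `|(EFin \o f) x| =
    \int[mu]_(x in D) (EFin \o f)^\+ x + \int[mu]_(x in D) (EFin \o f)^\- x)%E.
  rewrite -ge0_integralD//; [|exact: measurable_funepos|exact: measurable_funeneg].
  by apply: eq_integral => x _; rewrite -[LHS]/((abse \o (EFin \o f)) x) fune_abse.
move: fI; rewrite /I integralE.
move: Ip In; move: (\int[mu]_(x in D) _ ^\+ x)%E (\int[mu]_(x in D) _ ^\- x)%E.
by move=> [p||] [q||]//= _ _ _; rewrite -EFinD ltry.
Qed.

End Rintegral_ae.

Section positive_integral.
Context (R : realType) (n : nat).
Local Notation leb := (lebesgue R n).

Lemma lebesgue_ball_gt0 (c : 'rV[R]_n) (r : R) : 0 < r ->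
  (0 < leb [set x : 'rV[R]_n | (`|x - c| < r)%R])%E.
Proof.
move=> r0; pose B := [set x : 'rV[R]_n | forall i,
  x ord0 i \in `[(c - const_mx (r / 2)) ord0 i, (c + const_mx (r / 2)) ord0 i]].
apply: (@lt_le_trans _ _ (leb B)).
  rewrite lebesgue_box => [|i]; last by rewrite !mxE; lra.
  rewrite lte_fin; apply: prodr_gt0 => i _; rewrite !mxE; lra.
apply: le_measure; rewrite ?inE.
- apply: (@measurable_rV_box _ _ (fun i => `[(c - const_mx (r / 2)) ord0 i, (c + const_mx (r / 2)) ord0 i]%classic)).
  by move=> i; exact: measurable_itv.
- exact: measurable_rV_ball.
- move=> x Bx /=; apply: (@le_lt_trans _ _ (r / 2)); last lra.
  apply: rV_norm_le => [|i]; first lra.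
  by have := Bx i; rewrite !mxE in_itv /= ler_norml; lra.
Qed.

(** A zero integral would make f vanish almost everywhere, so the ball on which f > 0 would be
    negligible; but it contains a box of side r. *)
Lemma Rintegral_gt0 (D : set 'rV[R]_n) (f : 'rV[R]_n -> R) (c : 'rV[R]_n) (r : R) :
  measurable D -> 0 < r -> [set x | `|x - c| < r] `<=` D ->
  leb.-integrable D (EFin \o f) ->
  {ae leb, forall x, D x -> 0 <= f x} ->
  {ae leb, forall x, D x -> `|x - c| < r -> 0 < f x} ->
  0 < \int[leb]_(x in D) f x.
Proof.
move=> mD r0 BD fi f0 fp; rewrite lt_neqAle ae_Rintegral_ge0// andbT eq_sym.
apply/negP => /eqP; rewrite ae_RintegralE// => I0.
have mf := measurable_int leb fi.
have /(ae_eq_integral_abs _ mD mf) f_0 : (\int[leb]_(x in D) `|(EFin \o f) x| = 0)%E.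
  have fin : (\int[leb]_(x in D) `|(EFin \o f) x|)%E \is a fin_num.
    rewrite ge0_fin_numE; last by apply: integral_ge0 => x _; exact: abse_ge0.
    by have /integrableP[] := fi.
  by rewrite -(fineK fin) I0.
have : leb.-negligible [set x : 'rV[R]_n | `|x - c| < r].
  have : {ae leb, forall x, ~ (`|x - c| < r)}.
    apply: filterS2 fp f_0 => x /= fpx fx xc; have Dx := BD _ xc.
    have := fpx Dx xc; have [->] := fx Dx; by rewrite ltxx.
  by apply: negligibleS => x /= xc; apply.
move/(negligibleP _ (measurable_rV_ball c r)) => B0.
by have := lebesgue_ball_gt0 c r0; rewrite B0 ltxx.
Qed.

End positive_integral.

(** * The mixed operator on the bump function *)

Section frac_laplacian_bump.
Context (R : realType) (n : nat) (s : R) (c : 'rV[R]_n) (rho : R).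
Hypotheses (n_gt0 : (0 < n)%N) (s_gt0 : 0 < s) (s_lt1 : s < 1) (rho_gt0 : 0 < rho).
Local Notation leb := (lebesgue R n).
Local Notation phi := (bumpn c rho).
Local Notation p := (n%:R + 2 * s).

Lemma Rintegral_shift (a : 'rV[R]_n) (e : R) (f : 'rV[R]_n -> R) :
  e * e = 1 -> measurable_fun setT f ->
  \int[leb]_x f (a + e *: x) = \int[leb]_x f x.
Proof.
move=> e1 mf; congr fine.
by rewrite -(@lebesgue_integral_shift R n a e (EFin \o f))//; exact/measurable_EFinP.
Qed.

Definition trunc_kernel (N : nat) : 'rV[R]_n -> R :=
  annulus_weight s 0 (2 ^- N) (2 ^+ N).

Lemma trunc_kernelN N (z : 'rV[R]_n) : trunc_kernel N (- z) = trunc_kernel N z.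
Proof.
rewrite /trunc_kernel /annulus_weight frac_kernelN normrN !indicE.
by have -> : (- z \in annulus (2 ^- N) (2 ^+ N)) = (z \in annulus (2 ^- N) (2 ^+ N));
  first by apply/idP/idP; rewrite !inE /annulus /= normrN.
Qed.

Let mphi : measurable_fun setT phi.
Proof. exact: test_function_measurable (bumpn_test_function c rho_gt0). Qed.

Let mphi_shift x (e : R) : measurable_fun setT (fun z : 'rV[R]_n => phi (x + e *: z)).
Proof. by apply: (measurableT_comp mphi); exact: measurable_rV_affine. Qed.

Let phi_abs x : `|phi x| <= 1.
Proof. by rewrite ger0_norm ?bumpn_ge0 ?bumpn_le1. Qed.

Lemma bumpn_mass_gt0 : 0 < \int[leb]_x phi x.
Proof.
apply: (@Rintegral_gt0 _ _ _ _ c rho) => //.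
- by apply: test_function_integrable => //; exact: bumpn_test_function.
- by apply: aeW => x _; exact: bumpn_ge0.
- by apply: aeW => x _; exact: bumpn_gt0.
Qed.

Lemma pow2_inv_small (e : R) : 0 < e -> exists d : nat, 2 ^- d <= e.
Proof.
move=> e0; exists (Num.truncn e^-1).+1.
rewrite invf_ple ?posrE ?exprn_gt0//.
have h : e^-1 < (Num.truncn e^-1).+1%:R by rewrite truncnS_gt ?invr_ge0 ?ltW.
by apply: (le_trans (ltW h)); rewrite -natrX ler_nat ltnW// ltn_expl.
Qed.

(* kappa bounds the kernel from below on the support of the bump; once
   integrated, the term in - kappa absorbs the C2 and indicator terms when
   delta is small, leaving a multiple of phi x. *)
Let pointwise (C2 kappa delta : R) N (x z : 'rV[R]_n) : 0 <= C2 -> 0 < delta ->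
  2 ^- N <= delta -> delta <= 2 ^+ N -> 2 * rho <= 2 ^+ N -> `|x - c| < rho ->
  kappa = ((n%:R * (2 * rho)) `^ p)^-1 ->
  `|phi (x + z) + phi (x - z) - 2 * phi x| <= C2 * `|z| ^+ 2 ->
  (phi x - phi (x + z)) * trunc_kernel N z + (phi x - phi (x - z)) * trunc_kernel N z <=
  C2 * annulus_weight s 2 (2 ^- N) delta z + (2 * phi x) * annulus_weight s 0 delta (2 ^+ N) z
  - kappa * (phi (x + z) + phi (x - z)) + (2 * kappa) * \1_[set z : 'rV[R]_n | `|z - 0| <= delta] z.
Proof.
move=> C20 d0 Nd dN rhoN xc kE secd.
have k0 : 0 <= kappa by rewrite kE invr_ge0 powR_ge0.
have phi0 := bumpn_ge0 c rho; have phi1 := bumpn_le1 c rho.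
have phiz (y : 'rV[R]_n) : 2 * rho <= `|y| -> phi (x + y) = 0.
  move=> yr; apply: bumpn_eq0 => //.
  have : `|y| <= `|x + y - c| + `|x - c|.
    have E : y = (x + y - c) - (x - c) by rewrite opprB addrA subrK [x + y]addrC addrK.
    by rewrite {1}E; exact: ler_normB.
  by move: xc yr; lra.
rewrite -mulrDl (_ : phi x - phi (x + z) + _ = - (phi (x + z) + phi (x - z) - 2 * phi x)); last by ring.
have memA a b : (z \in annulus a b) = (a <= `|z| < b).
  by apply/idP/idP; rewrite inE.
have memB : (z \in [set z : 'rV[R]_n | `|z - 0| <= delta]) = (`|z| <= delta).
  by apply/idP/idP; rewrite inE /= subr0.
rewrite /trunc_kernel /annulus_weight !expr0 !mul1r !indicE !memA memB.
set k := frac_kernel s z; have fk0 : 0 <= k by exact: frac_kernel_ge0.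
(* For |z| < delta the second difference controls the kernel term, and the indicator pays for the
   term in - kappa because phi <= 1. *)
have [zd|dz] := ltP `|z| delta.
  rewrite (ltW zd) (lt_le_trans zd dN) /= !andbT !mulr0 addr0 mulr1.
  have H1 : 0 <= kappa * (2 - (phi (x + z) + phi (x - z))).
    by rewrite mulr_ge0// subr_ge0 (_ : 2 = 1 + 1)// lerD.
  have H2 : - (phi (x + z) + phi (x - z) - 2 * phi x) * (k * (2 ^- N <= `|z|)%R%:R) <=
      C2 * (`|z| ^+ 2 * k * (2 ^- N <= `|z|)%R%:R).
    rewrite -mulrA [leRHS]mulrA ler_wpM2r ?mulr_ge0 ?ler0n//.
    by rewrite (le_trans _ secd)// -normrN ler_norm.
  by move: H1 H2; lra.
rewrite andbF !mulr0 add0r /=.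
have [zN|Nz] := ltP `|z| (2 ^+ N); last first.
  rewrite andbF !mulr0 add0r (phiz z) ?(le_trans rhoN)//.
  rewrite (phiz (- z)) ?normrN ?(le_trans rhoN)// !addr0 mulr0 oppr0 add0r.
  by rewrite !mulr_ge0// ler0n.
rewrite andbT.
(* Either the shifted point has left the support, or |y| < 2 rho and the kernel is at least
   kappa. *)
have H (y : 'rV[R]_n) : `|y| = `|z| -> kappa * phi (x + y) <= k * phi (x + y).
  move=> yz; have [yr|yr] := leP (2 * rho) `|y|; first by rewrite phiz// !mulr0.
  rewrite ler_wpM2r// kE; apply: frac_kernel_ge => //; first exact: lt_le_trans dz.
  by rewrite -yz ltW.
have H1 := H _ erefl; have H2 := H (- z) (normrN z).
have I0 : 0 <= 2 * kappa * (`|z| <= delta)%R%:R by rewrite !mulr_ge0// ler0n.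
rewrite (le_trans Nd dz) /= !mulr1; move: H1 H2 I0; lra.
Qed.


Lemma integrable_shift_trunc N x (e : R) : leb.-integrable setT
  (EFin \o (fun z => (phi x - phi (x + e *: z)) * trunc_kernel N z)).
Proof.
have p2 : 0 < 2 ^- N :> R by rewrite invr_gt0 exprn_gt0.
have [C C0 HC] := annulus_weight_bound n s_gt0 0 (2 ^+ N) p2.
apply: (@integrable_bounded_support _ _ _ (2 * C) (2 ^+ N)) => //.
- apply: measurable_funM; first exact: measurable_funB.
  exact: measurable_annulus_weight.
- move=> z; rewrite normrM; apply: ler_pM => //; last exact: HC.
  by apply: (le_trans (ler_normB _ _)); rewrite (_ : 2 = 1 + 1)// lerD.
- by move=> z zN; rewrite /trunc_kernel annulus_weight_support// mulr0.
Qed.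

Let integrable_phi_shift x (e : R) : e * e = 1 ->
  leb.-integrable setT (EFin \o (fun z => phi (x + e *: z))).
Proof.
move=> e1; have [M HM] := test_function_support (bumpn_test_function c rho_gt0).
apply: (@integrable_bounded_support _ _ _ 1 (M + `|x|)) => // z zM; apply: HM.
have e_1 : `|e| = 1 by apply/eqP; rewrite -sqrp_eq1// -normrX expr2 e1 normr1.
have : `|z| <= `|x + e *: z| + `|x|.
  have E : e *: z = (x + e *: z) - x by rewrite addrAC subrr add0r.
  by rewrite -{1}(mul1r `|z|) -e_1 -normrZ {1}E; exact: ler_normB.
by move: zM; lra.
Qed.

(** Integrating the pointwise bound in z, the two shifts of phi both contribute the full mass m,
    whatever x is. Thus 2J is at most C2 D2 delta^(2-2s) + 2 T phi(x) - 2 kappa m + 2 kappa (2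
    delta)^n, and delta is chosen so that the first and last terms are each at most kappa m. T
    depends on delta but not on N. *)
Lemma trunc_laplacian_bump_le : exists2 T, 0 <= T & exists N0, forall N, (N0 <= N)%N ->
  forall x, \int[leb]_z ((phi x - phi (x + z)) * trunc_kernel N z) <= T * phi x.
Proof.
have combine (J A2 E2 a I0 T k m I1 D : R) :
    J + J <= A2 + (2 * a) * I0 - k * (m + m) + (2 * k) * I1 ->
    A2 <= E2 -> (2 * a) * I0 <= (2 * a) * T -> (2 * k) * I1 <= (2 * k) * D ->
    E2 <= k * m -> (2 * k) * D <= k * m -> J <= T * a by lra.
have [C2 C20 HC2] := bumpn_second_difference c rho_gt0.
pose m := \int[leb]_x phi x; have m0 : 0 < m := bumpn_mass_gt0.
pose kappa := ((n%:R * (2 * rho)) `^ p)^-1.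
have k0 : 0 < kappa.
  by rewrite invr_gt0 powR_gt0// mulr_gt0 ?ltr0n// mulr_gt0.
have b2 : 0 < 2%:R - 2 * s by rewrite subr_gt0 -[ltRHS]mulr1 ltr_pM2l.
have b0 : 0%:R - 2 * s < 0 by rewrite sub0r oppr_lt0 mulr_gt0.
pose D2 : R := 2 ^+ 2 * 4 ^+ n / (2 `^ (2%:R - 2 * s) - 1).
pose D0 : R := 2 ^+ 0 * 4 ^+ n / (1 - 2 `^ (0%:R - 2 * s)).
have near M b : 0 < b -> annulus_mass n s 2 (2 ^- M * b) b <= D2 * b `^ (2%:R - 2 * s).
  move=> bp; apply: dyadic_near => //.
  - by move=> *; exact: annulus_mass_add.
  - by move=> *; exact: annulus_mass_le.
have far M a : 0 < a -> annulus_mass n s 0 a (2 ^+ M * a) <= D0 * a `^ (0%:R - 2 * s).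
  move=> ap; apply: dyadic_far => //.
  - by move=> *; exact: annulus_mass_add.
  - by move=> *; exact: annulus_mass_le.
have D20 : 0 <= D2.
  apply: divr_ge0; first by rewrite mulr_ge0 ?exprn_ge0.
  by rewrite subr_ge0 /powR gt_eqF// -[leLHS]expR0 ler_expR mulr_ge0 ?(ltW b2)// ltW// ln_gt0// ltr1n.
have q0 : 0 < C2 * D2 + 1 by rewrite ltr_wpDl// mulr_ge0.
(* delta^(2-2s) <= e0 makes the near term at most kappa m; the added 1 avoids a zero denominator. *)
pose e0 : R := kappa * m / (C2 * D2 + 1).
have e00 : 0 < e0 by rewrite divr_gt0// mulr_gt0.
pose e1 : R := e0 `^ (2%:R - 2 * s)^-1.
have e10 : 0 < e1 by rewrite powR_gt0.
(* The bound 1/2 gives (2 delta)^n <= 2 delta, and then m/4 gives 2 kappa (2 delta) <= kappa m. *)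
have min0 : 0 < Num.min e1 (Num.min (1 / 2) (m / 4)).
  by rewrite !lt_min e10/= !divr_gt0.
have [d dP] := pow2_inv_small min0.
(* A power of 2, so that 2^-N and 2^N are dyadic multiples of delta and both dyadic bounds apply
   exactly. *)
pose delta : R := 2 ^- d; have d0 : 0 < delta by rewrite invr_gt0 exprn_gt0.
move: dP; rewrite -/delta !le_min => /and3P[de1 d12 dm4].
have small2 : C2 * (D2 * delta `^ (2%:R - 2 * s)) <= kappa * m.
  have : delta `^ (2%:R - 2 * s) <= e0.
    rewrite -[leRHS](powRr1 (ltW e00)) -[X in _ <= _ `^ X](mulVf (lt0r_neq0 b2)).
    by rewrite powRrM ge0_ler_powR ?nnegrE ?(ltW b2) ?(ltW d0) ?(ltW e10).
  rewrite mulrA => /(ler_wpM2l (mulr_ge0 C20 D20)) /le_trans; apply.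
  rewrite /e0 mulrCA ler_piMr ?mulr_ge0 ?(ltW k0) ?(ltW m0)//.
  by rewrite ler_pdivrMr// mul1r lerDl.
have small0 : 2 * kappa * (2 * delta) ^+ n <= kappa * m.
  have : (2 * delta) ^+ n <= 2 * delta.
    have dd : 0 <= 2 * delta <= 1 by move: d0 d12; lra.
    by case: (n) n_gt0 => // n' _; rewrite exprS ler_piMr ?exprn_ile1//; case/andP: dd.
  move=> /(ler_wpM2l (mulr_ge0 (ler0n _ 2) (ltW k0))) /le_trans; apply.
  rewrite [2 * kappa]mulrC -mulrA ler_wpM2l ?(ltW k0)//; move: dm4; lra.
have rho2 : 0 < (2 * rho)^-1 by rewrite invr_gt0 mulr_gt0.
have [e eP] := pow2_inv_small rho2.
pose T := D0 * delta `^ (0%:R - 2 * s).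
have D00 : 0 <= D0.
  apply: divr_ge0; first by rewrite mulr_ge0 ?exprn_ge0.
  by rewrite subr_ge0 /powR gt_eqF// expR_le1 pmulr_lle0 ?(ltW b0)// ln_gt0// ltr1n.
exists T; first by rewrite mulr_ge0// powR_ge0.
(* N >= d gives 2^-N <= delta, and N >= e gives 2 rho <= 2^N. *)
exists (d + e)%N => N deN x.
have i1 : leb.-integrable setT (EFin \o (fun z => (phi x - phi (x + z)) * trunc_kernel N z)).
  have := integrable_shift_trunc N x 1.
  rewrite (_ : (fun z => _) = (fun z => (phi x - phi (x + z)) * trunc_kernel N z))//.
  by apply/funext => z; rewrite scale1r.
have i2 : leb.-integrable setT (EFin \o (fun z => (phi x - phi (x - z)) * trunc_kernel N z)).
  have := integrable_shift_trunc N x (- 1).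
  rewrite (_ : (fun z => _) = (fun z => (phi x - phi (x - z)) * trunc_kernel N z))//.
  by apply/funext => z; rewrite scaleN1r.
(* Outside the support phi(x) = 0 and the integrand is - phi(x + z) times the kernel, hence
   nonpositive. *)
have [xc|xc] := ltP `|x - c| rho; last first.
  rewrite (bumpn_eq0 rho_gt0 xc) mulr0.
  apply: (@le_trans _ _ (\int[leb]_(z in setT) (0 : R))); last first.
    by rewrite /Rintegral integral0.
  apply: le_Rintegral => //; first by move: i1; rewrite (bumpn_eq0 rho_gt0 xc).
    exact: integrable0.
  move=> z _; rewrite sub0r mulNr oppr_le0 mulr_ge0 ?bumpn_ge0//.
  exact: annulus_weight_ge0.
have dN : (d <= N)%N by rewrite (leq_trans _ deN)// leq_addr.
have eN : (e <= N)%N by rewrite (leq_trans _ deN)// leq_addl.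
have Nd : 2 ^- N <= delta.
  by rewrite lef_pV2 ?posrE ?exprn_gt0// ler_weXn2l// ler1n.
have Np : 1 <= 2 ^+ N :> R by rewrite exprn_ege1// ler1n.
have dNp : delta <= 2 ^+ N by move: d12 Np; lra.
have rhoN : 2 * rho <= 2 ^+ N.
  apply: (@le_trans _ _ (2 ^+ e)); last by rewrite ler_weXn2l// ler1n.
  by rewrite -lef_pV2 ?posrE ?exprn_gt0// mulr_gt0.
set J := \int[leb]_z _.
have N11 : (- 1) * (- 1) = 1 :> R by rewrite mulrNN mulr1.
(* The kernel is even, so z and -z give the same integral, and their sum is a second difference. *)
have J2 : J + J = \int[leb]_z ((phi x - phi (x + z)) * trunc_kernel N z +
    (phi x - phi (x - z)) * trunc_kernel N z).
  have mf : measurable_fun setT (fun z => (phi x - phi (x + z)) * trunc_kernel N z).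
    have mf' := measurable_int leb i1; exact: (iffLR (measurable_EFinP _ _) mf').
  have J' : \int[leb]_z ((phi x - phi (x - z)) * trunc_kernel N z) = J.
    rewrite /J -(@Rintegral_shift 0 (- 1) _ N11 mf).
    by apply: eq_Rintegral => z _; rewrite add0r scaleN1r trunc_kernelN.
  by rewrite -{2}J' /J -(RintegralD measurableT i1 i2).
have N0 : 0 < 2 ^- N :> R by rewrite invr_gt0 exprn_gt0.
pose W2 := annulus_weight s 2 (2 ^- N) delta : 'rV[R]_n -> R.
pose W0 := annulus_weight s 0 delta (2 ^+ N) : 'rV[R]_n -> R.
pose B : set 'rV[R]_n := [set z | `|z - 0| <= delta].
have iW2 : leb.-integrable setT (EFin \o W2) by exact: integrable_annulus_weight.
have iW0 : leb.-integrable setT (EFin \o W0) by exact: integrable_annulus_weight.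
have mB : measurable B by exact: measurable_rV_closed_ball.
have iB : leb.-integrable setT (EFin \o (\1_B : _ -> R)).
  apply: (@integrable_bounded_support R n _ 1 delta) => //.
  - by move=> z; rewrite indicE; case: (_ \in _); rewrite ?normr1 ?normr0.
  - by move=> z za; rewrite indicE memNset// /B /= subr0; apply/negP; rewrite -ltNge.
have iP1 : leb.-integrable setT (EFin \o (fun z => phi (x + z))).
  have := @integrable_phi_shift x 1 (mulr1 _).
  rewrite (_ : (fun z => _) = (fun z => phi (x + z)))//.
  by apply/funext => z; rewrite scale1r.
have iP2 : leb.-integrable setT (EFin \o (fun z => phi (x - z))).
  have := integrable_phi_shift x N11.
  rewrite (_ : (fun z => _) = (fun z => phi (x - z)))//.
  by apply/funext => z; rewrite scaleN1r.
have P1 : \int[leb]_z phi (x + z) = m.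
  rewrite /m -(@Rintegral_shift x 1 _ (mulr1 _) mphi).
  by apply: eq_Rintegral => z _; rewrite scale1r.
have P2 : \int[leb]_z phi (x - z) = m.
  rewrite /m -(@Rintegral_shift x (- 1) _ N11 mphi).
  by apply: eq_Rintegral => z _; rewrite scaleN1r.
have iZ (a : R) f : leb.-integrable setT (EFin \o f) ->
    leb.-integrable setT (EFin \o (fun z => a * f z)).
  by move=> fi; have := integrableZl measurableT a fi.
have iD f g : leb.-integrable setT (EFin \o f) -> leb.-integrable setT (EFin \o g) ->
    leb.-integrable setT (EFin \o (fun z => f z + g z)).
  by move=> fi gi; have := integrableD measurableT fi gi.
have iS f g : leb.-integrable setT (EFin \o f) -> leb.-integrable setT (EFin \o g) ->
    leb.-integrable setT (EFin \o (fun z => f z - g z)).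
  by move=> fi gi; have := integrableB measurableT fi gi.
have iBd : \int[leb]_z \1_B z <= (2 * delta) ^+ n.
  rewrite /Rintegral integral_indic// setIT.
  have lB := lebesgue_ball_le (0 : 'rV[R]_n) (ltW d0).
  rewrite -lee_fin fineK; first exact: lB.
  by rewrite ge0_fin_numE; [exact: le_lt_trans lB (ltry _)|exact: measure_ge0].
have nearb : \int[leb]_z W2 z <= D2 * delta `^ (2%:R - 2 * s).
  have := near (N - d)%N delta d0.
  by rewrite /delta -invfM -exprD subnK.
have farb : \int[leb]_z W0 z <= T.
  have := far (N + d)%N delta d0.
  by rewrite /delta exprD mulfK// gt_eqF// exprn_gt0.
have : J + J <= C2 * \int[leb]_z W2 z + (2 * phi x) * \int[leb]_z W0 z -
    kappa * (m + m) + (2 * kappa) * \int[leb]_z \1_B z.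
  have iA1 := iZ C2 _ iW2; have iA2 := iZ (2 * phi x) _ iW0.
  have iA12 := iD _ _ iA1 iA2; have iPP := iD _ _ iP1 iP2.
  have iA3 := iZ kappa _ iPP; have iA123 := iS _ _ iA12 iA3.
  have iA4 := iZ (2 * kappa) _ iB.
  rewrite J2 -{1}P1 -P2 -(RintegralD measurableT iP1 iP2).
  rewrite -(RintegralZl kappa measurableT iPP) -(RintegralZl C2 measurableT iW2).
  rewrite -(RintegralZl (2 * phi x) measurableT iW0) -(RintegralZl (2 * kappa) measurableT iB).
  rewrite -(RintegralD measurableT iA1 iA2) -(RintegralB measurableT iA12 iA3).
  rewrite -(RintegralD measurableT iA123 iA4).
  have iL := iD _ _ i1 i2; have iR := iD _ _ iA123 iA4.
  apply: (le_Rintegral measurableT iL iR) => z _.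
  exact: pointwise.
move: (\int[leb]_z W2 z) (\int[leb]_z W0 z) (\int[leb]_z \1_B z) nearb farb iBd => I2 I0 I1 nearb farb iBd.
have := ler_wpM2l C20 nearb.
have := ler_wpM2l (mulr_ge0 (ler0n R 2) (bumpn_ge0 c rho x)) farb.
have := ler_wpM2l (mulr_ge0 (ler0n R 2) (ltW k0)) iBd.
move=> h1 h2 h3 h4; exact (combine _ _ _ _ _ _ _ _ _ _ h4 h3 h2 h1 small2 small0).
Qed.

End frac_laplacian_bump.

(** * Symmetrization and truncation of the nonlocal form *)

Section nonlocal.
Context (R : realType) (n : nat) (s : R) (c : 'rV[R]_n) (rho : R).
Hypotheses (n_gt0 : (0 < n)%N) (s_gt0 : 0 < s) (s_lt1 : s < 1) (rho_gt0 : 0 < rho).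
Local Notation leb := (lebesgue R n).
Local Notation phi := (bumpn c rho).
Variable u : 'rV[R]_n -> R.
Hypotheses (mu : measurable_fun [set: 'rV[R]_n] u) (iu : leb.-integrable setT (EFin \o u))
  (u_ge0 : {ae leb, forall x, 0 <= u x}).

Let mphi : measurable_fun setT phi.
Proof. exact: test_function_measurable (bumpn_test_function c rho_gt0). Qed.

Let mdiff : measurable_fun [set: 'rV[R]_n * 'rV[R]_n]
  (fun z : 'rV[R]_n * 'rV[R]_n => z.2 - z.1).
Proof.
apply/measurable_fun_rVP => i.
rewrite (_ : _ \o _ = (fun z => rV_coord i z.2 - rV_coord i z.1)).
  apply: measurable_funB; apply: measurableT_comp => //; exact: measurable_rV_coord.
by apply/funext => z; rewrite /rV_coord /= !mxE.
Qed.

(** One half of the truncated integrand, which is A(x,y) + A(y,x). Without truncation the halves may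
    fail to be integrable separately when s >= 1/2. *)
Let A N (z : 'rV[R]_n * 'rV[R]_n) : R :=
  u z.1 * (phi z.1 - phi z.2) * trunc_kernel s N (z.2 - z.1).

Let mu1 : measurable_fun [set: 'rV[R]_n * 'rV[R]_n] (fun z : 'rV[R]_n * 'rV[R]_n => u z.1).
Proof. exact: measurableT_comp. Qed.
Let mu2 : measurable_fun [set: 'rV[R]_n * 'rV[R]_n] (fun z : 'rV[R]_n * 'rV[R]_n => u z.2).
Proof. exact: measurableT_comp. Qed.
Let mphi1 : measurable_fun [set: 'rV[R]_n * 'rV[R]_n] (fun z : 'rV[R]_n * 'rV[R]_n => phi z.1).
Proof. exact: measurableT_comp. Qed.
Let mphi2 : measurable_fun [set: 'rV[R]_n * 'rV[R]_n] (fun z : 'rV[R]_n * 'rV[R]_n => phi z.2).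
Proof. exact: measurableT_comp. Qed.

Let mtk N : measurable_fun [set: 'rV[R]_n * 'rV[R]_n]
  (fun z : 'rV[R]_n * 'rV[R]_n => trunc_kernel s N (z.2 - z.1)).
Proof. by apply: measurableT_comp mdiff; exact: measurable_annulus_weight. Qed.

Let mA N : measurable_fun [set: 'rV[R]_n * 'rV[R]_n] (A N).
Proof. by apply: measurable_funM => //; apply: measurable_funM => //; exact: measurable_funB. Qed.

Let A' N (z : 'rV[R]_n * 'rV[R]_n) : R := A N (z.2, z.1).

Let mA' N : measurable_fun [set: 'rV[R]_n * 'rV[R]_n] (A' N).
Proof.
apply: (measurableT_comp (mA N)).
by apply: measurable_fun_pair; [exact: measurable_snd|exact: measurable_fst].
Qed.

Let pow2 N : 0 < 2 ^- N :> R. Proof. by rewrite invr_gt0 exprn_gt0. Qed.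

(** Since 0 <= phi <= 1, the inner integral is at most 2 tau |u(x)|, with tau the finite mass of the
    truncated kernel. *)
Let A_fubini N : (\int[leb]_x \int[leb]_y `|(A N (x, y))%:E| < +oo)%E.
Proof.
pose tau := \int[leb]_z trunc_kernel s N z.
have itk : leb.-integrable setT (EFin \o @trunc_kernel R n s N).
  exact: integrable_annulus_weight.
have tau0 : 0 <= tau by apply: Rintegral_ge0 => z _; exact: annulus_weight_ge0.
have tau20 : 0 <= 2 * tau by rewrite mulr_ge0.
have mt : measurable_fun setT (@trunc_kernel R n s N) by exact: measurable_annulus_weight.
apply: (@le_lt_trans _ _ (\int[leb]_x ((2 * tau)%:E * `|(u x)%:E|))%E).
  apply: ge0_le_integral => //.
  - by move=> x _; apply: integral_ge0 => y _; exact: abse_ge0.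
  - apply: (@measurable_fun_fubini_tonelli_F _ _ _ _ _ leb (fun z => `|(A N z)%:E|)%E) => //.
    by apply: measurableT_comp => //; exact/measurable_EFinP.
  - by apply: measurable_funeM; apply: measurableT_comp => //; exact/measurable_EFinP.
  - move=> x _.
    have tauE : (\int[leb]_y (trunc_kernel s N (y - x))%:E = tau%:E)%E.
      rewrite fineK; last exact: integrable_fin_num.
      have mE : measurable_fun setT (EFin \o @trunc_kernel R n s N) by exact/measurable_EFinP.
      rewrite -(@lebesgue_integral_shift R n (- x) 1 _ (mulr1 _) mE).
      by apply: eq_integral => y _; rewrite /= scale1r addrC.
    have mtx : measurable_fun [set: 'rV[R]_n] (fun y => (trunc_kernel s N (y - x))%:E).
      by apply/measurable_EFinP; exact: (measurableT_comp (mtk N) (pair1_measurable x)).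
    have t0 y : (0 <= (trunc_kernel s N (y - x))%:E)%E.
      by rewrite lee_fin annulus_weight_ge0.
    apply: (@le_trans _ _ (\int[leb]_y ((`|u x| * 2)%:E * (trunc_kernel s N (y - x))%:E))%E).
      apply: ge0_le_integral => //.
      + apply: measurableT_comp => //; apply/measurable_EFinP.
        exact: (measurableT_comp (mA N) (pair1_measurable x)).
      + exact: measurable_funeM.
      + move=> y _; rewrite -EFinM lee_fin /A /= normrM (normrM (u x)).
        rewrite [X in _ * X <= _]ger0_norm ?annulus_weight_ge0//.
        rewrite ler_wpM2r ?annulus_weight_ge0// ler_wpM2l//.
        rewrite (le_trans (ler_normB _ _))// (_ : 2 = 1 + 1)//.
        by rewrite !ger0_norm ?bumpn_ge0// lerD// bumpn_le1.
    rewrite (ge0_integralZl_EFin leb measurableT (fun y _ => t0 y) mtx) ?mulr_ge0//.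
    rewrite tauE /= -!EFinM lee_fin.
    by have -> : `|u x| * 2 * tau = 2 * tau * `|u x| by ring.
have mabsu : measurable_fun setT (fun x => `|(u x)%:E|%E).
  by apply: measurableT_comp => //; exact/measurable_EFinP.
rewrite (ge0_integralZl_EFin leb measurableT (fun x _ => abse_ge0 _) mabsu tau20).
by rewrite lte_mul_pinfty//; have /integrableP[] := iu.
Qed.

Let iA N : (leb \x leb)%E.-integrable setT (EFin \o A N).
Proof. by apply/integrable12ltyP; [exact/measurable_EFinP|exact: A_fubini]. Qed.

Let iA' N : (leb \x leb)%E.-integrable setT (EFin \o A' N).
Proof. by apply/integrable21ltyP; [exact/measurable_EFinP|exact: A_fubini]. Qed.

Let A_slice N x : (\int[leb]_y (A N (x, y))%:E =
  (u x * \int[leb]_z ((phi x - phi (x + z)) * trunc_kernel s N z))%:E)%E.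
Proof.
have mf : measurable_fun setT (fun y => (A N (x, y))%:E).
  by apply/measurable_EFinP; exact: (measurableT_comp (mA N) (pair1_measurable x)).
rewrite -(@lebesgue_integral_shift R n x 1 _ (mulr1 _) mf).
have iS : leb.-integrable setT (EFin \o
    (fun z => (phi x - phi (x + 1 *: z)) * trunc_kernel s N z)).
  exact: integrable_shift_trunc.
rewrite EFinM /Rintegral fineK; last first.
  have := integrable_fin_num measurableT iS.
  by under eq_integral do rewrite /= scale1r.
transitivity (\int[leb]_z ((u x)%:E * (EFin \o
    (fun z => ((phi x - phi (x + 1 *: z)) * trunc_kernel s N z)%R)) z))%E.
  apply: eq_integral => z _.
  have E : (x + 1 *: z) - x = z by rewrite scale1r addrAC subrr add0r.
  by rewrite -EFinM /A /= E -mulrA.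
rewrite (integralZl measurableT iS (u x)); apply: congr1.
by apply: eq_integral => z _; rewrite /= scale1r.
Qed.

Let A'E N : (\int[(leb \x leb)%E]_z (A' N z)%:E = \int[(leb \x leb)%E]_z (A N z)%:E)%E.
Proof. by rewrite -(integral21_prod_meas1 (iA' N)) -(integral12_prod_meas1 (iA N)). Qed.

Let iuphi : leb.-integrable setT (EFin \o (fun x => u x * phi x)).
Proof.
apply: (le_integrable measurableT _ _ iu).
  by apply/measurable_EFinP; exact: measurable_funM.
move=> x _; rewrite lee_fin normrM ler_piMr// ger0_norm ?bumpn_ge0//.
exact: bumpn_le1.
Qed.

Let A_le N (T : R) :
  (forall x, \int[leb]_z ((phi x - phi (x + z)) * trunc_kernel s N z) <= T * phi x) ->
  (\int[(leb \x leb)%E]_z (A N z)%:E <= (T * \int[leb]_x (u x * phi x))%:E)%E.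
Proof.
move=> HT; rewrite -(integral12_prod_meas1 (iA N)).
pose J x := \int[leb]_z ((phi x - phi (x + z)) * trunc_kernel s N z).
have FE : fubini_F leb (EFin \o A N) = (fun x => (u x * J x)%:E).
  by apply/funext => x; exact: A_slice.
have iJ := integrable_fubini_F (iA N); rewrite FE in iJ *.
have iTu : leb.-integrable setT (EFin \o (fun x => T * (u x * phi x))).
  exact: (integrableZl measurableT T iuphi).
rewrite -RintegralZl// -(fineK (integrable_fin_num measurableT iJ)) lee_fin.
apply: (@ae_le_Rintegral _ _ _ leb setT (fun x => u x * J x)) => //.
apply: filterS u_ge0 => x ux _; rewrite mulrCA ler_wpM2l//; exact: HT.
Qed.

(* No integrability of the double integrand is assumed: a measurable function
   that is not integrable has Rintegral 0. *)
Lemma nonlocal_form_le (T : R) (N0 : nat) : 0 <= T ->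
  (forall N, (N0 <= N)%N -> forall x,
    \int[leb]_z ((phi x - phi (x + z)) * trunc_kernel s N z) <= T * phi x) ->
  \int[(leb \x leb)%E]_z ((u z.1 - u z.2) * (phi z.1 - phi z.2) /
    enorm (z.1 - z.2) `^ (n%:R + 2 * s)) <= 2 * T * \int[leb]_x (u x * phi x).
Proof.
move=> T0 HT.
pose g (z : 'rV[R]_n * 'rV[R]_n) := (u z.1 - u z.2) * (phi z.1 - phi z.2) *
  frac_kernel s (z.2 - z.1).
have -> : \int[(leb \x leb)%E]_z ((u z.1 - u z.2) * (phi z.1 - phi z.2) /
    enorm (z.1 - z.2) `^ (n%:R + 2 * s)) = \int[(leb \x leb)%E]_z g z.
  by apply: eq_Rintegral => z _; rewrite /g -frac_kernelN opprB.
have mg : measurable_fun setT g.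
  apply: measurable_funM; last first.
    by apply: measurableT_comp mdiff; exact: measurable_frac_kernel.
  by apply: measurable_funM; exact: measurable_funB.
have I0 : 0 <= \int[leb]_x (u x * phi x).
  apply: ae_Rintegral_ge0 => //; apply: filterS u_ge0 => x ux _.
  by rewrite mulr_ge0// bumpn_ge0.
have [ig|nig] := pselect ((leb \x leb)%E.-integrable setT (EFin \o g)); last first.
  by rewrite Rintegral_non_integrable// !mulr_ge0.
pose gN N z := A N z + A' N z.
have gNE N z : gN N z = g z * \1_(annulus (2 ^- N) (2 ^+ N)) (z.2 - z.1).
  rewrite /gN /A' /A /g /= -[trunc_kernel s N (z.1 - z.2)]trunc_kernelN opprB.
  rewrite /trunc_kernel /annulus_weight expr0; ring.
have igN N : (leb \x leb)%E.-integrable setT (EFin \o gN N).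
  exact: (integrableD measurableT (iA N) (iA' N)).
have gN_le N : (N0 <= N)%N ->
    (\int[(leb \x leb)%E]_z (gN N z)%:E <= (2 * T * \int[leb]_x (u x * phi x))%:E)%E.
  move=> N0N; under eq_integral do rewrite EFinD.
  rewrite (integralD measurableT (iA N) (iA' N)) A'E.
  (* Both halves have the same integral, whence the factor 2. *)
  have := A_le (HT N N0N) => h; rewrite (le_trans (leeD h h))// -EFinD lee_fin; lra.
have [] := @dominated_convergence _ _ R (leb \x leb)%E setT measurableT
  (fun N z => (gN N z)%:E) (EFin \o g) (fun z => `|(g z)%:E|)%E.
- by move=> N; exact: (measurable_int _ (igN N)).
- exact/measurable_EFinP.
(* Off the diagonal the truncation is eventually inactive; on it both functions vanish. *)
- apply: aeW => z _; apply: cvg_near_cst.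
  have [zz|zz] := eqVneq (z.2 - z.1) 0.
    have g0 : g z = 0 by rewrite /g (subr0_eq zz) subrr mul0r mul0r.
    by apply: nearW => N; rewrite gNE /= g0 mul0r.
  have w0 : 0 < `|z.2 - z.1| by rewrite normr_gt0.
  have [d dP] := pow2_inv_small w0.
  (* The outer end of the annulus is excluded, so 2^N must exceed |z.2 - z.1| strictly; hence the
     added 1. *)
  have w1 : 0 < (`|z.2 - z.1| + 1)^-1 by rewrite invr_gt0 addr_gt0.
  have [e eP] := pow2_inv_small w1.
  exists (d + e)%N => // N /= deN; rewrite gNE indicE mem_set ?mulr1//.
  apply/andP; split.
    apply: le_trans dP; rewrite lef_pV2 ?posrE ?exprn_gt0// ler_weXn2l ?ler1n//.
    by rewrite (leq_trans _ deN)// leq_addr.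
  apply: (@lt_le_trans _ _ (2 ^+ e)).
    apply: (@lt_le_trans _ _ (`|z.2 - z.1| + 1)); first by rewrite ltrDl.
    by rewrite -lef_pV2 ?posrE ?exprn_gt0 ?addr_gt0.
  by rewrite ler_weXn2l ?ler1n// (leq_trans _ deN)// leq_addl.
- exact: integrable_abse.
- apply: aeW => z N _; rewrite lee_fin gNE normrM ler_piMr//.
  by rewrite indicE; case: (_ \in _); rewrite ?normr1 ?normr0.
move=> _ _ cvg_gN.
rewrite -lee_fin fineK; last exact: integrable_fin_num.
rewrite -(cvg_lim _ cvg_gN)//; apply: lime_le; first by apply/cvg_ex; eexists; exact: cvg_gN.
by exists N0 => // N N0N; exact: gN_le.
Qed.

End nonlocal.

(** * Nonexistence for large parameters *)

Section solution_estimates.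
Context (R : realType) (n : nat).
Local Notation leb := (lebesgue R n).
Implicit Types (D K : set 'rV[R]_n) (f g : 'rV[R]_n -> R).

Lemma Rintegral_sum d (T : measurableType d) (mu : {measure set T -> \bar R})
    (I : Type) (s : seq I) (A : set T) (h : I -> T -> R) : measurable A ->
  (forall i, mu.-integrable A (EFin \o h i)) ->
  mu.-integrable A (EFin \o (fun x => \sum_(i <- s) h i x)) /\
  \int[mu]_(x in A) (\sum_(i <- s) h i x) = \sum_(i <- s) \int[mu]_(x in A) h i x.
Proof.
move=> mA ih; elim: s => [|i s [IH1 IH2]].
  rewrite big_nil; split.
    by under eq_fun do rewrite big_nil; exact: integrable0.
  by under eq_Rintegral do rewrite big_nil; rewrite /Rintegral integral0.
have E : (fun x => \sum_(j <- i :: s) h j x) = (fun x => h i x + \sum_(j <- s) h j x).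
  by apply/funext => x; rewrite big_cons.
rewrite E big_cons -IH2; split; last exact: RintegralD.
exact: (integrableD mA (ih i) IH1).
Qed.

Lemma integrableM_bounded D f g (C : R) : measurable D ->
  leb.-integrable D (EFin \o f) -> measurable_fun D g -> (forall x, `|g x| <= C) ->
  leb.-integrable D (EFin \o (fun x => f x * g x)).
Proof.
move=> mD fi mg gC; have C0 : 0 <= C by apply: le_trans (gC 0).
apply: (le_integrable mD _ _ (integrableZl mD C fi)).
  have mf := measurable_int leb fi.
  apply/measurable_EFinP; apply: measurable_funM => //.
  exact: (iffLR (measurable_EFinP _ _) mf).
move=> x _ /=; rewrite lee_fin !normrM mulrC (ger0_norm C0).
by rewrite ler_wpM2r.
Qed.

(** Meant for the weak gradient of u, which is only locally integrable: the product lives on the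
    compact support of the test function. *)
Lemma integrable_compact_support D K f g (C : R) : measurable D -> measurable K ->
  K `<=` D -> leb.-integrable K (EFin \o f) -> measurable_fun setT g ->
  (forall x, `|g x| <= C) -> (forall x, ~ K x -> g x = 0) ->
  leb.-integrable D (EFin \o (fun x => f x * g x)).
Proof.
move=> mD mK KD fi mg gC gK.
have mgK : measurable_fun K g by exact: measurable_funS mg.
have := integrableM_bounded mK fi mgK gC.
move/(integrable_mkcond _ mK) => h; apply/(integrable_mkcond _ mD).
rewrite (_ : _ \_ D = (EFin \o (fun x => f x * g x)) \_ K)//.
apply/funext => x; rewrite /patch; case: ifPn => xD; case: ifPn => xK //.
- by move: xK; rewrite notin_setE => /gK /= ->; rewrite mulr0.
- by move: xD; rewrite notin_setE; move: xK; rewrite inE => /KD.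
Qed.

(** With U = K^(1/(r-1)): for t >= U, t^r = t t^(r-1) >= K t; for t < U, K t t^gamma <= K
    U^(gamma+1) <= lambda. *)
Lemma power_reaction_ge (gamma r K lambda t : R) : 0 < gamma -> 1 < r -> 0 < K ->
  K * (K `^ (r - 1)^-1) `^ (gamma + 1) <= lambda -> 0 < t ->
  K * t <= lambda / t `^ gamma + t `^ r.
Proof.
move=> g0 r1 K0 lamK t0; pose U := K `^ (r - 1)^-1.
have r10 : 0 < r - 1 by rewrite subr_gt0.
have U0 : 0 < U by rewrite powR_gt0.
have UK : U `^ (r - 1) = K by rewrite -powRrM mulVf ?gt_eqF// powRr1// ltW.
have lam0 : 0 <= lambda.
  by apply: le_trans lamK; rewrite mulr_ge0 ?powR_ge0// ltW.
have [Ut|tU] := leP U t.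
  rewrite -[leLHS]add0r lerD ?divr_ge0 ?powR_ge0//.
  rewrite -(mulr_powRB1 (ltW t0) (lt_trans ltr01 r1)) mulrC ler_wpM2l ?(ltW t0)// -UK.
  by rewrite ge0_ler_powR ?nnegrE ?(ltW r10) ?(ltW U0) ?(ltW t0).
rewrite -[leLHS]addr0 lerD ?powR_ge0//.
have tU' : t `^ gamma <= U `^ gamma.
  by rewrite ge0_ler_powR ?nnegrE ?(ltW g0) ?(ltW U0) ?(ltW t0) ?(ltW tU).
rewrite ler_pdivlMr ?powR_gt0// (le_trans _ lamK)// -mulrA ler_wpM2l ?(ltW K0)//.
rewrite powRD ?(gt_eqF U0) ?implybT// powRr1 ?(ltW U0)// mulrC.
by rewrite ler_pM ?powR_ge0// ltW.
Qed.

End solution_estimates.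

(** * Testing the equation with the bump *)

Section bump_test.
Context (R : realType) (n : nat) (Omega : set 'rV[R]_n) (c : 'rV[R]_n) (rho : R).
Hypotheses (oOmega : open Omega) (rho_gt0 : 0 < rho)
  (subOmega : [set x | `|x - c| <= 2 * rho] `<=` Omega).
Local Notation leb := (lebesgue R n).
Local Notation phi := (bumpn c rho).
Local Notation w := [set x : 'rV[R]_n | `|x - c| < 2 * rho].

Let mOmega : measurable Omega. Proof. exact: open_measurable_rV. Qed.

Let phi_support_sub : [set x | `|x - c| <= rho] `<=` w.
Proof. by move=> x /= /le_lt_trans; apply; rewrite ltr_pMl// ltr1n. Qed.

Let phi_sub : [set x | `|x - c| <= rho] `<=` Omega.
Proof. by move=> x /phi_support_sub /= /ltW; exact: subOmega. Qed.

(** The cube of radius 2 rho leaves room for an open set between the support of phi and Omega. *)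
Let compactly_contained_w : compactly_contained w Omega.
Proof.
have cl := @closed_rV_closed_ball R n c (2 * rho).
have sub : closure w `<=` [set x : 'rV[R]_n | `|x - c| <= 2 * rho].
  rewrite [X in _ `<=` X](closure_id _).1//; apply: closureS => x /= xc; exact: ltW.
split; last exact: subset_trans subOmega.
apply: subclosed_compact sub; first exact: closed_closure.
exact: compact_rV_closed_ball.
Qed.

Let test_w : test_function w phi.
Proof. exact: test_functionS (bumpn_test_function c rho_gt0). Qed.

Let test_Omega : test_function Omega phi.
Proof. exact: test_functionS (bumpn_test_function c rho_gt0). Qed.

(** Each partial derivative of phi is itself a test function, so the definition of the weak gradient
    moves the second derivative onto phi; the Laplacian bound is then multiplied by u >= 0. *)
Lemma local_form_le (u : 'rV[R]_n -> R) Du (C : R) :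
  weak_gradient Omega u Du -> leb.-integrable Omega (EFin \o u) ->
  {ae leb, forall x, Omega x -> 0 <= u x} ->
  (forall x, - (\sum_i partial i (partial i phi) x) <= C * phi x) ->
  \int[leb]_(x in Omega) (\sum_(i < n) Du i x * partial i phi x) <=
  C * \int[leb]_(x in Omega) (u x * phi x).
Proof.
move=> [_ wg] iu u0 HC.
have mK : measurable [set x : 'rV[R]_n | `|x - c| <= rho] by exact: measurable_rV_closed_ball.
have testK := bumpn_test_function c rho_gt0.
have iDu i : leb.-integrable Omega (EFin \o (fun x => Du i x * partial i phi x)).
  have [[_ L1] _] := wg i; have td := test_function_partial i testK.
  have [M _ HM] := test_function_bounded td.
  apply: (@integrable_compact_support _ _ Omega [set x : 'rV[R]_n | `|x - c| <= rho] _ _ M) => //.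
  - by apply: L1 => //; exact: compact_rV_closed_ball.
  - exact: test_function_measurable td.
  - by move=> x; exact: test_function_eq0 td.
have iuM g : test_function Omega g -> leb.-integrable Omega (EFin \o (fun x => u x * g x)).
  move=> tg; have [M _ HM] := test_function_bounded tg.
  apply: (@integrableM_bounded _ _ Omega u g M) => //.
  by apply: (measurable_funS measurableT) => //; exact: test_function_measurable tg.
have td2 i : test_function Omega (partial i (partial i phi)).
  by do 2 apply: test_function_partial.
have [is1 ->] := Rintegral_sum (index_enum 'I_n) mOmega iDu.
have E i : \int[leb]_(x in Omega) (Du i x * partial i phi x) =
    - \int[leb]_(x in Omega) (u x * partial i (partial i phi) x).
  have [_ /(_ _ (test_function_partial i test_Omega)) ->] := wg i.
  by rewrite opprK.
rewrite (eq_bigr _ (fun i _ => E i)) sumrN.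
have [is2 <-] := Rintegral_sum (index_enum 'I_n) mOmega (fun i => iuM _ (td2 i)).
rewrite -(RintegralZl C mOmega (iuM _ test_Omega)).
rewrite -subr_ge0 opprK.
have iC : leb.-integrable Omega (EFin \o (fun x => C * (u x * phi x))).
  exact: (integrableZl mOmega C (iuM _ test_Omega)).
rewrite -(RintegralD mOmega iC is2); apply: ae_Rintegral_ge0 => //.
  exact: (integrableD mOmega iC is2).
apply: filterS u0 => x u0 Ox; rewrite -mulr_sumr mulrCA -mulrDr mulr_ge0 ?u0//.
by have := HC x; lra.
Qed.

(** C + T plays the part of an eigenvalue: with S the integral of u phi, the equation gives K S <= C
    S + T S, and S > 0 is cancelled. *)
Lemma eigenvalue_estimate (s gamma r lambda K T C : R) (u : 'rV[R]_n -> R) :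
  bounded_set Omega -> 0 < gamma -> 1 < r -> 0 < K ->
  K * (K `^ (r - 1)^-1) `^ (gamma + 1) <= lambda ->
  (forall x, - (\sum_i partial i (partial i phi) x) <= C * phi x) ->
  (forall v, measurable_fun [set: 'rV[R]_n] v -> leb.-integrable setT (EFin \o v) ->
    {ae leb, forall x, 0 <= v x} ->
    \int[(leb \x leb)%E]_z ((v z.1 - v z.2) * (phi z.1 - phi z.2) /
      enorm (z.1 - z.2) `^ (n%:R + 2 * s)) <= T * \int[leb]_x (v x * phi x)) ->
  weak_solution Omega s gamma r lambda u -> K <= C + T.
Proof.
move=> bOmega g0 r1 K0 lamK HC HT [_ [mu [M uM]] u_gt0 u_eq0 _ [Du wg weq]].
have lOmega := bounded_lebesgue_lty mOmega bOmega.
(* u vanishes at every point outside Omega, so measurability and integrability pass from Omega to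
   the whole space, where the nonlocal form is defined. *)
have uE : u \_ Omega = u.
  by apply/funext => x; rewrite /patch; case: ifPn => //; rewrite notin_setE => /u_eq0.
have muT : measurable_fun setT u.
  by rewrite -uE; apply/(measurable_restrictT _ mOmega).
have ae_int (f : 'rV[R]_n -> R) (B : R) : measurable_fun Omega f ->
    {ae leb, forall x, Omega x -> `|f x| <= B} -> leb.-integrable Omega (EFin \o f).
  move=> mf fB; apply/integrableP; split; first exact/measurable_EFinP.
  apply: (@le_lt_trans _ _ (`|B|%:E * leb Omega)%E).
    apply: integral_le_bound => //; first exact/measurable_EFinP.
    by apply: filterS fB => x fB /fB /= h; rewrite lee_fin (le_trans h)// ler_norm.
  by rewrite lte_mul_pinfty.
have iu : leb.-integrable Omega (EFin \o u) by exact: ae_int uM.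
have iuT : leb.-integrable setT (EFin \o u).
  by have /(integrable_mkcond _ mOmega) := iu; rewrite restrict_EFin uE.
have u_ge0 : {ae leb, forall x, 0 <= u x}.
  apply: filterS u_gt0 => x ux; have [/ux/ltW//|/u_eq0 ->//] := pselect (Omega x).
have u_ge0' : {ae leb, forall x, Omega x -> 0 <= u x} by apply: filterS u_ge0.
have [iphi weak] := weq w phi (@open_rV_ball R n c (2 * rho)) compactly_contained_w
  (test_function_W12_0 (open_measurable_rV (@open_rV_ball R n c (2 * rho))) test_w).
have := weak _ (test_function_weak_gradient measurableT test_w).
have := local_form_le wg iu u_ge0' HC.
have := HT u muT iuT u_ge0.
have SE : \int[leb]_x (u x * phi x) = \int[leb]_(x in Omega) (u x * phi x).
  rewrite [RHS]Rintegral_mkcond; apply: eq_Rintegral => x _.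
  by rewrite /patch; case: ifPn => //; rewrite notin_setE => /u_eq0 ->; rewrite mul0r.
rewrite SE.
have [B B0 phiB] := test_function_bounded test_w.
have mphi : measurable_fun Omega phi.
  by apply: (measurable_funS measurableT) => //; exact: test_function_measurable test_w.
have iuphi : leb.-integrable Omega (EFin \o (fun x => u x * phi x)).
  exact: integrableM_bounded phiB.
have S0 : 0 < \int[leb]_(x in Omega) (u x * phi x).
  apply: (@Rintegral_gt0 _ _ _ _ c rho) => //.
  - by move=> x /= /ltW; exact: phi_sub.
  - by apply: filterS u_ge0' => x ux /ux h; rewrite mulr_ge0// bumpn_ge0.
  - by apply: filterS u_gt0 => x ux /ux h xc; rewrite mulr_gt0// bumpn_gt0.
have iur : leb.-integrable Omega (EFin \o (fun x => u x `^ r * phi x)).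
  apply: (ae_int _ (`|M| `^ r * B)).
    apply: measurable_funM => //.
    by apply: (measurableT_comp (measurable_powR r)).
  apply: filterS2 uM u_ge0' => x uM u0 Ox; rewrite normrM ler_pM//.
  rewrite ger0_norm ?powR_ge0// ge0_ler_powR ?nnegrE ?u0//.
    by rewrite (le_trans ler01)// ltW.
  by have := uM Ox; rewrite ger0_norm ?u0// => /le_trans; apply; exact: ler_norm.
have : K * \int[leb]_(x in Omega) (u x * phi x) <=
    lambda * \int[leb]_(x in Omega) (phi x / u x `^ gamma) +
    \int[leb]_(x in Omega) (u x `^ r * phi x).
  have i1 : leb.-integrable Omega (EFin \o (fun x => lambda * (phi x / u x `^ gamma))).
    exact: (integrableZl mOmega lambda iphi).
  rewrite -(RintegralZl K mOmega iuphi) -(RintegralZl lambda mOmega iphi).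
  rewrite -(RintegralD mOmega i1 iur); apply: ae_le_Rintegral => //.
  - exact: (integrableZl mOmega K iuphi).
  - exact: (integrableD mOmega i1 iur).
  - apply: filterS u_gt0 => x ux /ux h.
    have := power_reaction_ge g0 r1 K0 lamK h.
    move=> /(ler_wpM2r (bumpn_ge0 c rho x)) /le_trans; rewrite -mulrA; apply.
    by rewrite mulrDl mulrA mulrAC.
move=> h1 h2 h3 h4; rewrite -(ler_pM2r S0) mulrDl; move: h1 h2 h3 h4; lra.
Qed.

End bump_test.

Theorem mainTheorem4 (R : realType) (n : nat) (Omega : set 'rV[R]_n)
    (s gamma r : R) :
  (0 < n)%N -> bounded_C1_domain Omega ->
  0 < s -> s < 1 -> 0 < gamma -> 1 < r ->
  exists2 Lambda : R, 0 < Lambda &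
    forall lambda : R, Lambda <= lambda ->
      ~ exists u : 'rV[R]_n -> R, weak_solution Omega s gamma r lambda u.
Proof.
move=> n0 [oOmega _ [c Oc] bOmega _] s0 s1 g0 r1.
have /nbhs_ballP[e /= e0 eO] : nbhs c Omega by apply: open_nbhs_nbhs; split.
(* The closed cube of radius 2 rho = e/2 then lies inside the open ball of radius e. *)
pose rho := e / 4; have rho0 : 0 < rho by rewrite divr_gt0.
have sub : [set x | `|x - c| <= 2 * rho] `<=` Omega.
  move=> x /= xc; apply: eO; rewrite mx_norm_ball /ball_ /= distrC.
  by rewrite (le_lt_trans xc)// /rho; lra.
have [C C0 HC] := bumpn_laplacian c rho.
have [T T0 [N0 HT]] := trunc_laplacian_bump_le c n0 s0 s1 rho0.
(* One more than the bound C + 2T that any solution would impose on K. *)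
pose K := C + 2 * T + 1.
have K0 : 0 < K by rewrite /K; lra.
exists (K * (K `^ (r - 1)^-1) `^ (gamma + 1)).
  by rewrite mulr_gt0// !powR_gt0.
move=> lambda lamK [u wu].
have := eigenvalue_estimate oOmega rho0 sub bOmega g0 r1 K0 lamK HC _ wu.
move=> /(_ (2 * T)) H; have : K <= C + 2 * T.
  apply: H => v mv iv v0.
  exact: nonlocal_form_le T0 HT.
rewrite /K; lra.
Qed.
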